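(* Let $M$ be a smooth finite-dimensional manifold, $\pi:P\to M$ a smooth principal bundle whose structure group is a Lie group $G$, and $\mathcal B$ a smooth diffusion operator on $P$ which is equivariant. Let $\mathcal A$ be the induced diffusion operator on $M$, $\mathcal A f(x)=\mathcal B(f\circ\pi)(u)$ for $u\in\pi^{-1}(x)$, $f\in C^2(M)$. Assume that the symbol $\sigma^{\mathcal A}$ has constant rank, and let $E\subset TM$ be the sub-bundle with fibres $E_x=\mathrm{Image}(\sigma^{\mathcal A}_x)$. Then $\sigma^{\mathcal B}$ gives rise to an $E$ semi-connection on the principal bundle $P$, whose horizontal lift map $h_u:E_{\pi(u)}\to T_uP$, $u\in P$, is given by $$h_u(v)=\sigma^{\mathcal B}_u\big((T_u\pi)^*\alpha\big),\qquad v\in E_{\pi(u)},$$ where $\alpha\in T^*_{\pi(u)}M$ is any covector satisfying $\sigma^{\mathcal A}_{\pi(u)}(\alpha)=v$.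
   Context: Symbol: for a second order differential operator $\mathcal L$ on a manifold $X$, the symbol $\sigma^{\mathcal L}:T^*X\to TX$ is determined by $df(\sigma^{\mathcal L}(dg))=\tfrac12\mathcal L(fg)-\tfrac12 \mathcal L(f)g-\tfrac12 f\mathcal L(g)$ for $C^2$ functions $f,g$. $\mathcal L$ is semi-elliptic if $df(\sigma^{\mathcal L}(df))\ge 0$ for all $f\in C^2(X)$; it is a diffusion operator if it is semi-elliptic and annihilates constants; it is smooth if it sends smooth functions to smooth functions. Equivariance: writing $R_a:P\to P$ for right translation by $a\in G$, $\mathcal B$ is equivariant if $(\mathcal Bf)\circ R_a=\mathcal B(f\circ R_a)$ for all $f\in C^2(P,\mathbb R)$ and $a\in G$. This makes the induced operator $\mathcal A$ well defined. Semi-connection: for a sub-bundle $E$ of $TM$, an $E$ semi-connection on $\pi:P\to M$ is a smooth sub-bundle $H^ETP$ of $TP$ such that (i) $T_u\pi$ maps $H^ET_uP$ bijectively onto $E_{\pi(u)}$ for all $u\in P$; (ii) $H^ETP$ is $G$-invariant. Equivalently, it is given by a smooth horizontal lift map: linear maps $h_u:E_{\pi(u)}\to T_uP$, smooth in $u\in P$, with $T_u\pi\circ h_u(v)=v$ for all $v\in E_{\pi(u)}$ and $h_{u\cdot a}=T_uR_a\circ h_u$ for all $a\in G$; then $H^ET_uP$ is the image of $h_u$. *)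

(* Defs.v *)
From HB Require Import structures.
From mathcomp Require Import all_boot all_order all_algebra.
From mathcomp Require Import all_classical all_reals all_analysis.

Set Implicit Arguments.
Unset Strict Implicit.
Unset Printing Implicit Defensive.

Import Order.TTheory GRing.Theory Num.Theory.
Import numFieldNormedType.Exports.

Local Open Scope classical_set_scope.
Local Open Scope ring_scope.

(* C^k functions on an open subset D of R^n: the differential exists on D and,
   evaluated at any fixed vector, is C^(k-1) there. *)
Fixpoint Ck_on (R : realType) (n k : nat) (D : set 'rV[R]_n)
    (f : 'rV[R]_n -> R^o) : Prop :=
  if k is k'.+1 then
    (forall p, D p -> differentiable f p) /\
    (forall v, Ck_on k' D (fun p => 'd f p v))
  else forall p, D p -> {for p, continuous f}.

Definition Coo_on (R : realType) (n : nat) (D : set 'rV[R]_n)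
    (f : 'rV[R]_n -> R^o) : Prop := forall k, Ck_on k D f.

(* The map [cfwd] is only meaningful on [cdom], and [cbwd] on the image of
   [cdom]; outside they take arbitrary values. *)
Record chart (R : realType) (n : nat) (X : Type) := Chart {
  cdom : set X;
  cfwd : X -> 'rV[R]_n;
  cbwd : 'rV[R]_n -> X }.

Definition chart_axiom (R : realType) (n : nat) (X : topologicalType)
    (phi : chart R n X) : Prop :=
  [/\ open (cdom phi),
      open (cfwd phi @` cdom phi),
      forall x, cdom phi x -> cbwd phi (cfwd phi x) = x,
      forall x, cdom phi x -> {for x, continuous (cfwd phi)} &
      forall x, cdom phi x -> {for cfwd phi x, continuous (cbwd phi)}].

Definition compatible (R : realType) (n : nat) (X : Type)
    (phi psi : chart R n X) : Prop :=
  forall j, Coo_on (cfwd phi @` (cdom phi `&` cdom psi))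
                   (fun p => cfwd psi (cbwd phi p) 0 j).

HB.mixin Record isManifold (R : realType) (n : nat) X of Topological X := {
  atlas : set (chart R n X);
  manifold_hausdorff : hausdorff_space X;
  manifold_second_countable : @second_countable X;
  atlas_chart : forall phi, atlas phi -> chart_axiom phi;
  atlas_cover : forall x : X, exists2 phi, atlas phi & cdom phi x;
  atlas_compatible : forall phi psi,
    atlas phi -> atlas psi -> compatible phi psi }.

#[short(type="manifoldType")]
HB.structure Definition Manifold (R : realType) (n : nat) :=
  { X of Topological X & isManifold R n X }.

Definition prod_chart (R : realType) (n m : nat) (X Y : Type)
    (phi : chart R n X) (psi : chart R m Y) : chart R (n + m) (X * Y) :=
  Chart (cdom phi `*` cdom psi)
        (fun z => row_mx (cfwd phi z.1) (cfwd psi z.2))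
        (fun p => (cbwd phi (lsubmx p), cbwd psi (rsubmx p))).

Definition prod_atlas (R : realType) (n m : nat) (X Y : Type)
    (AX : set (chart R n X)) (AY : set (chart R m Y)) :
    set (chart R (n + m) (X * Y)) :=
  [set chi | exists phi psi, [/\ AX phi, AY psi & chi = prod_chart phi psi]].

(* Smoothness, on an open set D, of a map between spaces carrying the atlases
   AX and AY; the atlases are arguments so that this also applies to
   products, through [prod_atlas]. *)
Definition smooth_on (R : realType) (n m : nat) (X Y : topologicalType)
    (AX : set (chart R n X)) (AY : set (chart R m Y))
    (D : set X) (f : X -> Y) : Prop :=
  (forall x, D x -> {for x, continuous f}) /\
  (forall phi psi, AX phi -> AY psi -> forall j,
     Coo_on (cfwd phi @` (cdom phi `&` D `&` f @^-1` cdom psi))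
            (fun p => cfwd psi (f (cbwd phi p)) 0 j)).

HB.mixin Record isLieGroup (R : realType) (n : nat) G
    of Manifold R n G & Group G := {
  mulg_smooth : smooth_on (prod_atlas (@atlas R n G) (@atlas R n G))
    (@atlas R n G) setT (fun ab : G * G => (ab.1 * ab.2)%g);
  invg_smooth : smooth_on (@atlas R n G) (@atlas R n G) setT
    (fun a : G => (a^-1)%g) }.

#[short(type="lieGroupType")]
HB.structure Definition LieGroup (R : realType) (n : nat) :=
  { G of Manifold R n G & Group G & isLieGroup R n G }.

Section Calculus.
Context (R : realType) (n : nat) (X : manifoldType R n).
Local Notation atlasX := (@atlas R n X).

Definition Ck_fun (k : nat) (f : X -> R) : Prop :=
  forall phi, atlasX phi -> Ck_on k (cfwd phi @` cdom phi) (f \o cbwd phi).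

Definition smooth_fun (f : X -> R) : Prop := forall k, Ck_fun k f.

(* The tangent space T_x X is represented by 'rV[R]_n, through the chart
   [chart_at x] chosen once and for all at x, and T*_x X by its dual
   'Hom('rV[R]_n, R^o). *)
Definition chart_at (x : X) : chart R n X := projT1 (cid2 (@atlas_cover R n X x)).

Definition dfun (f : X -> R) (x : X) : 'Hom('rV[R]_n, R^o) :=
  linfun ('d ((f \o cbwd (chart_at x)) : 'rV[R]_n -> R^o)
             (cfwd (chart_at x) x)).

(* the isomorphism T_x X -> R^n given by an arbitrary chart at x *)
Definition tcoord (phi : chart R n X) (x : X) : 'Hom('rV[R]_n, 'rV[R]_n) :=
  linfun ('d (cfwd phi \o cbwd (chart_at x)) (cfwd (chart_at x) x)).

Definition smooth_vfield (D : set X) (V : X -> 'rV[R]_n) : Prop :=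
  forall phi, atlasX phi -> forall j,
    Coo_on (cfwd phi @` (cdom phi `&` D))
           (fun p => tcoord phi (cbwd phi p) (V (cbwd phi p)) 0 j).

Definition smooth_subbundle (E : X -> {vspace 'rV[R]_n}) : Prop :=
  exists r : nat, forall x0 : X, exists (U : set X) (V : 'I_r -> X -> 'rV[R]_n),
    [/\ open U, U x0, forall i, smooth_vfield U (V i) &
        forall x, U x -> basis_of (E x) [tuple V i x | i < r]].

(* Operators act on all functions X -> R, but only their values on C^2
   functions are ever constrained or used. *)
Definition second_order_operator (L : (X -> R) -> X -> R) : Prop :=
  forall phi, atlasX phi ->
    exists (a : X -> 'M[R]_n) (b : X -> 'rV[R]_n) (c : X -> R),
    forall f, Ck_fun 2 f -> forall x, cdom phi x ->
      let f' : 'rV[R]_n -> R^o := f \o cbwd phi in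
      let D i (g : 'rV[R]_n -> R^o) : 'rV[R]_n -> R^o :=
        'D_('e_i : 'rV[R]_n) g in
      L f x = \sum_(i < n) \sum_(j < n) a x i j * D i (D j f') (cfwd phi x)
              + \sum_(i < n) b x 0 i * D i f' (cfwd phi x)
              + c x * f x.

Definition symbol_spec (L : (X -> R) -> X -> R) (x : X)
    (s : 'Hom('Hom('rV[R]_n, R^o), 'rV[R]_n)) : Prop :=
  forall f g, Ck_fun 2 f -> Ck_fun 2 g ->
    dfun f x (s (dfun g x)) =
      2^-1 * L (f \* g) x - 2^-1 * L f x * g x - 2^-1 * f x * L g x.

(* the linear map T*_x X -> T_x X determined by [symbol_spec] *)
Definition symbol (L : (X -> R) -> X -> R) (x : X) :
    'Hom('Hom('rV[R]_n, R^o), 'rV[R]_n) := xget 0 [set s | symbol_spec L x s].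

Definition semi_elliptic (L : (X -> R) -> X -> R) : Prop :=
  forall f, Ck_fun 2 f -> forall x,
    (0 : R) <= dfun f x (symbol L x (dfun f x)).

Definition diffusion_operator (L : (X -> R) -> X -> R) : Prop :=
  [/\ second_order_operator L, semi_elliptic L &
      forall c : R, L (cst c) = cst 0].

Definition smooth_operator (L : (X -> R) -> X -> R) : Prop :=
  forall f, smooth_fun f -> smooth_fun (L f).

Definition symbol_image (L : (X -> R) -> X -> R) (x : X) :
  {vspace 'rV[R]_n} := limg (symbol L x).

Definition constant_rank_symbol (L : (X -> R) -> X -> R) : Prop :=
  exists r : nat, forall x, \dim (symbol_image L x) = r.

End Calculus.

Definition tmap (R : realType) (n m : nat) (X : manifoldType R n)
    (Y : manifoldType R m) (f : X -> Y) (x : X) : 'Hom('rV[R]_n, 'rV[R]_m) :=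
  linfun ('d (cfwd (chart_at (f x)) \o f \o cbwd (chart_at x))
             (cfwd (chart_at x) x)).

Definition cotmap (R : realType) (n m : nat) (X : manifoldType R n)
    (Y : manifoldType R m) (f : X -> Y) (x : X)
    (alpha : 'Hom('rV[R]_m, R^o)) : 'Hom('rV[R]_n, R^o) :=
  (alpha \o tmap f x)%VF.

Section PrincipalBundle.
Context (R : realType) (n m k : nat).
Context (M : manifoldType R n) (P : manifoldType R m) (G : lieGroupType R k).
Context (proj : P -> M) (act : P -> G -> P).
Local Notation atlasM := (@atlas R n M).
Local Notation atlasP := (@atlas R m P).
Local Notation atlasG := (@atlas R k G).

(* u |-> (proj u, tau u) is a G-equivariant diffeomorphism of proj^-1(U) onto
   U x G, with inverse theta. *)
Definition local_trivialization (U : set M) (tau : P -> G)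
    (theta : M * G -> P) : Prop :=
  [/\ smooth_on atlasP atlasG (proj @^-1` U) tau,
      smooth_on (prod_atlas atlasM atlasG) atlasP (U `*` setT) theta,
      forall u, U (proj u) -> theta (proj u, tau u) = u,
      forall x a, U x -> proj (theta (x, a)) = x /\ tau (theta (x, a)) = a &
      forall u a, U (proj u) -> tau (act u a) = (tau u * a)%g].

Record principal_bundle : Prop := PrincipalBundle {
  proj_smooth : smooth_on atlasP atlasM setT proj;
  act_smooth : smooth_on (prod_atlas atlasP atlasG) atlasP setT
    (fun ua : P * G => act ua.1 ua.2);
  act1 : forall u, act u 1%g = u;
  actM : forall u a b, act u (a * b)%g = act (act u a) b;
  proj_act : forall u a, proj (act u a) = proj u;
  locally_trivial : forall x : M, exists (U : set M) (tau : P -> G)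
    (theta : M * G -> P), [/\ open U, U x & local_trivialization U tau theta] }.

Definition equivariant (B : (P -> R) -> P -> R) : Prop :=
  forall f, Ck_fun 2 f -> forall a,
    B f \o act^~ a = B (f \o act^~ a).

Definition induced_operator (B : (P -> R) -> P -> R) (A : (M -> R) -> M -> R)
  : Prop :=
  forall f, Ck_fun 2 f -> forall x u, proj u = x -> A f x = B (f \o proj) u.

Definition semi_connection (E : M -> {vspace 'rV[R]_n})
    (H : P -> {vspace 'rV[R]_m}) : Prop :=
  [/\ smooth_subbundle E,
      smooth_subbundle H,
      forall u, set_bij [set` H u] [set` E (proj u)] (tmap proj u) &
      forall u a, (tmap (act^~ a) u @: H u)%VS = H (act u a)].

(* h u is the horizontal lift at u; only its values on E (proj u) matter.
   Smoothness: h carries smooth local sections of E to smooth vector fields. *)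
Definition horizontal_lift_map (E : M -> {vspace 'rV[R]_n})
    (H : P -> {vspace 'rV[R]_m}) (h : P -> 'rV[R]_n -> 'rV[R]_m) : Prop :=
  [/\ forall u (c : R), {in E (proj u) &, forall v w,
        h u (c *: v + w) = c *: h u v + h u w},
      forall u, {in E (proj u), forall v, tmap proj u (h u v) = v},
      forall (W : set M) (V : M -> 'rV[R]_n), open W ->
        smooth_vfield W V -> (forall x, W x -> V x \in E x) ->
        smooth_vfield (proj @^-1` W) (fun u => h u (V (proj u))),
      forall u a, {in E (proj u), forall v,
        h (act u a) v = tmap (act^~ a) u (h u v)} &
      forall u, h u @` [set` E (proj u)] = [set` H u]].

End PrincipalBundle.

(* Main.v *)
(* The symbol of A is the pushforward of the symbol of B,
     sigma^A_{pi u} = T_u pi o sigma^B_u o (T_u pi)^*,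
   because B (f o pi) = (A f) o pi.  If sigma^A kills alpha then the quadratic
   form of sigma^B vanishes at (T_u pi)^* alpha; being symmetric and nonnegative,
   sigma^B kills (T_u pi)^* alpha, so h_u is well defined, linear, and a section
   of T_u pi.  Equivariance of h is read off from that of B by testing against
   functions.  Everything smooth reduces to the fact that
   u |-> df (sigma^B (dg)) is the smooth function
   (B(fg) - B(f) g - f B(g)) / 2 for smooth f and g: choosing functions f_i on M
   whose vectors sigma^A(df_i) form a basis of E at one point, the Gram matrix
   df_j (sigma^A (df_i)) stays invertible nearby, so that sigma^A(df_i) is a
   local frame of E and sigma^B(d(f_i o pi)) one of H^E TP.  Bump functions
   supply enough globally defined smooth functions. *)

Require Import Defs.
From HB Require Import structures.
From mathcomp Require Import all_boot all_order all_algebra.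
From mathcomp Require Import all_classical all_reals all_analysis.
From mathcomp Require Import perm ring.

Set Implicit Arguments.
Unset Strict Implicit.
Unset Printing Implicit Defensive.

Import Order.TTheory GRing.Theory Num.Theory.
Import numFieldNormedType.Exports.

Local Open Scope classical_set_scope.
Local Open Scope ring_scope.

(** * Functions of class C^k on open subsets of R^n *)

(** [symbol] is obtained by choice from [symbol_spec], so existence and uniqueness must be proved
    before any formula for it can be used. Uniqueness rests on every covector at x being the
    differential of a globally defined smooth function. Existence for [B] comes from the symmetrised
    second order coefficients in a chart. For [A] only the values on C^2 functions are prescribed,
    so the pushforward formula itself supplies existence, and smoothness of [A] is pulled down from
    [B] along local sections of the bundle. The tangent space at x is R^n through a chart chosen at
    x, and this choice may jump with x. The components of a vector field V therefore say nothing
    about its smoothness by themselves. Smoothness is tested instead on the scalar functions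
    [dfun g y (V y)] for smooth g on the whole manifold, which is also the form in which the symbol
    is known. *)

Section Differential.
Context (R : realType) (V W : normedModType R).
Implicit Types (f g : V -> W) (p : V).

(** The conclusion is the pair of properties that characterises the differential of g, with ['d f p]
    as candidate; uniqueness of differentials then gives the value of ['d g p], and with it
    differentiability. *)
Lemma near_eq_diff_locally f g p : {near p, f =1 g} -> differentiable f p ->
  continuous ('d f p) /\ g \o shift p = cst (g p) + 'd f p +o_ 0 id.
Proof.
move=> fg df; split; first exact: diff_continuous.
have := diff_locally df => /eqaddoP fE.
apply/eqaddoP => e e0.
have {}fE := fE e e0.
have {}fg0 : \forall h \near (0 : V), (fun q => f q = g q) (h + p).
  rewrite (near_shift p); apply: filterS (fg : nbhs p _) => q fgq.
  by rewrite /= sub0r addrNK.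
have fgp := nbhs_singleton fg; near=> h.
have fgh : f (h + p) = g (h + p) by near: h; exact: fg0.
have : `|(f \o shift p - (cst (f p) + 'd f p)) h| <= e * `|h| by near: h; exact: fE.
by rewrite !fctE /= fgh fgp.
Unshelve. all: by end_near. Qed.

Lemma near_eq_diff f g p : {near p, f =1 g} -> differentiable f p ->
  'd g p = 'd f p :> (V -> W).
Proof. by move=> fg df; apply/diff_unique; have [] := near_eq_diff_locally fg df. Qed.

Lemma near_eq_differentiable f g p :
  {near p, f =1 g} -> differentiable f p -> differentiable g p.
Proof.
move=> fg df; apply/diff_locallyP; rewrite (near_eq_diff fg df).
exact: near_eq_diff_locally.
Qed.

End Differential.

Section DifferentialAt.
Context (R : realType) (V : normedModType R).
Implicit Types (f g : V -> R^o) (p v : V).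

Lemma near_eq_diff_at f g p v : {near p, f =1 g} -> differentiable f p ->
  'd g p v = 'd f p v.
Proof. by move=> fg df; have /(congr1 (@^~ v)) := near_eq_diff fg df. Qed.

Lemma diffD_at f g p v : differentiable f p -> differentiable g p ->
  'd (f \+ g) p v = 'd f p v + 'd g p v.
Proof. by move=> df dg; have /(congr1 (@^~ v)) := diffD df dg. Qed.

Lemma differentiable_mul f g p : differentiable f p -> differentiable g p ->
  differentiable (fun q => f q * g q : R^o) p.
Proof. exact: (@differentiableM R V f g). Qed.

Lemma diffM_at f g p v : differentiable f p -> differentiable g p ->
  'd (fun q => f q * g q : R^o) p v = f p * 'd g p v + g p * 'd f p v.
Proof.
by move=> df dg; have /(congr1 (@^~ v)) := @diffM R V f g p df dg.
Qed.

Lemma diff_comp_at (W : normedModType R) (h : V -> W) (g : W -> R^o) p v :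
  differentiable h p -> differentiable g (h p) ->
  'd (g \o h) p v = 'd g (h p) ('d h p v).
Proof. by move=> dh dg; have /(congr1 (@^~ v)) := diff_comp dh dg. Qed.

(** Chain rule in the form that charts require: the two maps of a chart are mutually inverse only
    locally, so a coordinate expression equals a composite only near p. *)
Lemma diff_comp_near (W : normedModType R) (h : V -> W) (g : W -> R^o) f p q v :
  h p = q -> {near p, g \o h =1 f} -> differentiable h p -> differentiable g q ->
  'd f p v = 'd g q ('d h p v).
Proof.
move=> <- ghf dh dg; rewrite -(diff_comp_at v dh dg).
exact: near_eq_diff_at ghf (differentiable_comp dh dg).
Qed.

Lemma differentiable_inv f p : differentiable f p -> f p != 0 ->
  differentiable (fun q => (f q)^-1 : R^o) p.
Proof. exact: (@differentiableV R V f). Qed.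

Lemma diffV_at f p v : differentiable f p -> f p != 0 ->
  'd (fun q => (f q)^-1 : R^o) p v = - ((f p)^-1 * (f p)^-1 * 'd f p v).
Proof.
move=> df f0; have /(congr1 (@^~ v)) := @diffV R V f p df f0.
by move=> ->; rewrite -mulNr -invfM -expr2.
Qed.

End DifferentialAt.

Section RowValued.
Context (R : realType) (V : normedModType R) (m : nat).
Implicit Types (F : V -> 'rV[R]_m) (p : V).

Lemma row_continuous_at (T : topologicalType) (F : T -> 'rV[R]_m) (x : T) :
  (forall j, {for x, continuous (fun y => F y 0 j : R)}) -> {for x, continuous F}.
Proof.
move=> cF A [P nP PA].
have : \forall y \near x, forall j, P 0 j (F y 0 j).
  by apply: filter_forall => j; apply: cF; exact: nP.
rewrite /nbhs /=; apply: filterS => y Py; apply: PA => i j.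
by rewrite (ord1 i).
Qed.

Lemma row_differentiable F p :
  (forall j, differentiable (fun y => F y 0 j : R^o) p) -> differentiable F p.
Proof.
move=> dF; rewrite (_ : F = \sum_j (fun y => F y 0 j *: 'e_j)).
  by apply: differentiable_sum => j; apply: differentiableZl; apply: dF.
by apply/funext => y; rewrite fct_sumE [LHS]row_sum_delta.
Qed.

Lemma diff_coord F p v j : differentiable F p ->
  'd F p v 0 j = 'd (fun y => F y 0 j : R^o) p v.
Proof.
move=> dF.
have @c : {linear 'rV[R]_m -> R^o}.
  by exists (fun N : 'rV[R]_m => N 0 j); do 2![eexists]; do ?[constructor];
     rewrite ?mxE// => ? *; rewrite ?mxE//; move=> ?; rewrite !mxE.
have cc : continuous c by exact: coord_continuous.
have -> : (fun y => F y 0 j : R^o) = c \o F by [].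
rewrite (diff_comp dF (linear_differentiable _ cc)) /=.
by rewrite (diff_lin _ cc).
Qed.

End RowValued.

Section CkOn.
Context (R : realType) (n : nat).
Implicit Types (f g : 'rV[R]_n -> R^o) (D : set 'rV[R]_n) (p : 'rV[R]_n).

Lemma Ck_on_sub k D D' f : D `<=` D' -> Ck_on k D' f -> Ck_on k D f.
Proof.
move=> DD'; elim: k f => [|k IH] f /=; first by move=> cf p /DD'; exact: cf.
by move=> [df Cf]; split=> [p /DD'|v]; [exact: df|exact: IH].
Qed.

Lemma Ck_onW k D f : Ck_on k.+1 D f -> Ck_on k D f.
Proof.
elim: k f => [|k IH] f [df Cf]; first by move=> p /df/differentiable_continuous.
by split=> // v; exact/IH/Cf.
Qed.

Lemma Ck_on_leq k l D f : (k <= l)%N -> Ck_on l D f -> Ck_on k D f.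
Proof.
move=> /subnK <-; elim: (l - k)%N f => [//|i IH] f.
by rewrite addSn => /Ck_onW/IH.
Qed.

(** [Ck_on] is a condition at each point, on differentials taken in the ambient space, so it can be
    checked with a different set at each point. *)
Lemma Ck_on_bigcup k D f :
  (forall p, D p -> exists2 D', D' p & Ck_on k D' f) -> Ck_on k D f.
Proof.
elim: k f => [|k IH] f H /=; first by move=> p /H[D' D'p]; exact.
split=> [p /H[D' D'p [df _]]|v]; first exact: df.
by apply: IH => p /H[D' D'p [_ Cf]]; exists D' => //; exact: Cf.
Qed.

Lemma open_near_eq D f g p : open D -> D p -> {in D, f =1 g} -> {near p, f =1 g}.
Proof.
move=> oD Dp fg; apply: filterS (open_nbhs_nbhs (conj oD Dp)) => q Dq.
by apply: fg; rewrite inE.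
Qed.

Lemma Ck_on_ext k D f g : open D -> {in D, f =1 g} -> Ck_on k D f -> Ck_on k D g.
Proof.
move=> oD; elim: k f g => [|k IH] f g fg.
  move=> cf p Dp; have fgp := open_near_eq oD Dp fg.
  rewrite /prop_for /continuous_at -(nbhs_singleton fgp).
  exact: cvg_trans (near_eq_cvg fgp) (cf p Dp).
move=> [df Cf]; split=> [p Dp|v].
  exact: near_eq_differentiable (open_near_eq oD Dp fg) (df p Dp).
apply: IH (Cf v) => p; rewrite inE => Dp.
exact: esym (near_eq_diff_at v (open_near_eq oD Dp fg) (df p Dp)).
Qed.

Lemma Ck_on_cst k D (a : R) : Ck_on k D (cst a : _ -> R^o).
Proof.
elim: k a => [|k IH] a; first by move=> p _; exact: cst_continuous.
split=> [p _|v]; first exact: differentiable_cst.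
rewrite (_ : (fun _ => _) = cst 0) //.
by apply/funext => p; rewrite diff_cst.
Qed.

Lemma Ck_on_linear k D (f : {linear 'rV[R]_n -> R^o}) :
  continuous f -> Ck_on k D f.
Proof.
move=> cf; case: k => [|k]; first by move=> p _; exact: cf.
split=> [p _|v]; first exact: linear_differentiable.
rewrite (_ : (fun _ => _) = cst (f v)); first exact: Ck_on_cst.
by apply/funext => p; rewrite diff_lin.
Qed.

Lemma Ck_onD k D f g : open D -> Ck_on k D f -> Ck_on k D g -> Ck_on k D (f \+ g).
Proof.
move=> oD; elim: k f g => [|k IH] f g.
  by move=> cf cg p Dp; exact: cvgD (cf p Dp) (cg p Dp).
move=> [df Cf] [dg Cg]; split=> [p Dp|v].
  by apply: differentiableD; [exact: df|exact: dg].
apply: Ck_on_ext oD _ (IH _ _ (Cf v) (Cg v)) => p; rewrite inE => Dp /=.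
exact/esym/(diffD_at v (df p Dp) (dg p Dp)).
Qed.

Lemma Ck_onM k D f g : open D -> Ck_on k D f -> Ck_on k D g ->
  Ck_on k D (fun p => f p * g p).
Proof.
move=> oD; elim: k f g => [|k IH] f g.
  by move=> cf cg p Dp; exact: cvgM (cf p Dp) (cg p Dp).
move=> Cf1 Cg1; have := Cf1; have := Cg1; move=> [dg Cg] [df Cf].
split=> [p Dp|v].
  exact: differentiable_mul (df p Dp) (dg p Dp).
apply: Ck_on_ext oD _ (Ck_onD oD (IH _ _ (Ck_onW Cf1) (Cg v))
  (IH _ _ (Ck_onW Cg1) (Cf v))) => p; rewrite inE => Dp /=.
exact/esym/(diffM_at v (df p Dp) (dg p Dp)).
Qed.

Lemma Ck_onN k D f : open D -> Ck_on k D f -> Ck_on k D (fun p => - f p).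
Proof.
move=> oD Cf; apply: Ck_on_ext oD _ (Ck_onM oD (Ck_on_cst k D (-1)) Cf) => p _ /=.
by rewrite mulN1r.
Qed.

Lemma Ck_onV k D f : open D -> (forall p, D p -> f p != 0) -> Ck_on k D f ->
  Ck_on k D (fun p => (f p)^-1).
Proof.
move=> oD f0; elim: k => [|k IH].
  by move=> cf p Dp; exact: cvgV (f0 p Dp) (cf p Dp).
move=> Cf1; have := Cf1; move=> [df Cf].
split=> [p Dp|v].
  exact: differentiable_inv (df p Dp) (f0 p Dp).
have CfV := IH (Ck_onW Cf1).
apply: Ck_on_ext oD _ (Ck_onN oD (Ck_onM oD (Ck_onM oD CfV CfV) (Cf v))) => p.
rewrite inE => Dp /=.
exact/esym/(diffV_at v (df p Dp) (f0 p Dp)).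
Qed.

End CkOn.

Lemma Ck_on_comp (R : realType) (n m k : nat) (D : set 'rV[R]_n)
    (D' : set 'rV[R]_m) (F : 'rV[R]_n -> 'rV[R]_m) (g : 'rV[R]_m -> R^o) :
  open D -> (forall j, Ck_on k D (fun p => F p 0 j : R^o)) ->
  (forall p, D p -> D' (F p)) -> Ck_on k D' g -> Ck_on k D (g \o F).
Proof.
move=> oD; elim: k g => [|k IH] g CF FD.
  move=> cg p Dp; apply: continuous_comp; last exact/cg/FD.
  by apply: row_continuous_at => j; exact: CF.
move=> [dg Cg].
have dF p : D p -> differentiable F p.
  by move=> Dp; apply: row_differentiable => j; have [dF _] := CF j; exact: dF.
split=> [p Dp|v].
  by apply: differentiable_comp; [exact: dF|exact/dg/FD].
have {}IH := IH _ (fun j => Ck_onW (CF j)) FD.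
(* The chain rule in coordinates: each summand is a product of a derivative of [F] and a partial
   derivative of g composed with [F], and the induction hypothesis, which is general in g, covers
   the latter. *)
pose h := \sum_(j < m) (fun p => 'd (fun q => F q 0 j : R^o) p v * 'd g (F p) 'e_j : R^o).
apply: (@Ck_on_ext _ _ _ _ h) => //.
  move=> p; rewrite inE => Dp; rewrite diff_comp; [|exact: dF|exact/dg/FD].
  rewrite /= [in RHS](row_sum_delta ('d F p v)) linear_sum /= /h fct_sumE.
  by apply: eq_bigr => j _; rewrite linearZ /= diff_coord//; exact: dF.
rewrite /h; elim/big_rec: _ => [|j x _ Cx]; first exact: Ck_on_cst.
apply: Ck_onD => //; apply: Ck_onM => //; first by have [_] := CF j; exact.
exact: (IH (fun y => 'd g y 'e_j) (Cg _)).
Qed.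

(** * Smooth bump functions *)

Section Bump.
Context (R : realType).

(* Indexed by the power of 1/t so that the family is closed under
   differentiation. *)
Definition flat (k : nat) (t : R) : R :=
  if 0 < t then t^-1 ^+ k * expR (- t^-1) else 0.

Lemma flat_gt0 k t : 0 < t -> 0 < flat k t.
Proof.
by move=> t0; rewrite /flat t0 mulr_gt0// ?expR_gt0// exprn_gt0// invr_gt0.
Qed.

Lemma flat_eq0 k t : t <= 0 -> flat k t = 0.
Proof. by move=> t0; rewrite /flat ltNge t0. Qed.

Lemma flat_ge0 k t : 0 <= flat k t.
Proof. by have [/(flat_gt0 k)/ltW//|/(flat_eq0 k)->] := ltP 0 t. Qed.

(** The exponential series at x = 1/t gives expR x >= x^(k+1) / (k+1)!. One power of x more than
    [flat k] contains leaves the factor t, hence continuity at 0. *)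
Lemma flat_le k t : `|flat k t| <= (k.+1)`!%:R * `|t|.
Proof.
rewrite ger0_norm ?flat_ge0//; have [t0|t0] := ltP 0 t; last first.
  by rewrite flat_eq0// mulr_ge0.
rewrite /flat t0 gtr0_norm// expRN ler_pdivrMr ?expR_gt0//.
have x0 : 0 < t^-1 by rewrite invr_gt0.
have := expR_ge1Dxn k (ltW x0).
set x := t^-1 => H.
have f0 : (0 : R) < (k.+1)`!%:R by rewrite ltr0n fact_gt0.
have {}H : x ^+ k.+1 <= (k.+1)`!%:R * expR x.
  rewrite -ler_pdivrMl//; apply: le_trans H; rewrite mulrC lerDr.
  exact: ler01.
have -> : (k.+1)`!%:R * t * expR x = t * ((k.+1)`!%:R * expR x).
  by rewrite [_ * t]mulrC mulrA.
rewrite -ler_pdivrMl// -/x; apply: le_trans H.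
by rewrite exprS.
Qed.

Lemma flat_cvg0 k : flat k h @[h --> 0] --> (0 : R).
Proof.
have n0 : (k.+1)`!%:R * `|h| @[h --> (0 : R)] --> (0 : R).
  rewrite -[X in _ --> X](mulr0 (k.+1)`!%:R); apply: cvgMr.
  by rewrite -[X in _ --> X](@normr0 R R); apply: cvg_norm; exact: cvg_id.
apply: (@squeeze_cvgr _ _ _ _ (fun h => - ((k.+1)`!%:R * `|h|))
  (fun h => (k.+1)`!%:R * `|h|)) => //.
  by near=> h; rewrite -ler_norml flat_le.
by rewrite -[X in _ --> X]oppr0; exact: cvgN.
Unshelve. all: by end_near. Qed.

Lemma is_derive_flat k t :
  is_derive t (1 : R) (flat k) (flat k.+2 t - k%:R * flat k.+1 t).
Proof.
case: (ltgtP 0 t) => [t0|t0|<-].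
- have nt : \forall s \near t, s^-1 ^+ k * expR (- s^-1) = flat k s.
    by near=> s; rewrite /flat ifT//; near: s; exact: lt_nbhsr.
  apply: near_eq_is_derive nt _.
  have t1 : t != 0 by rewrite gt_eqF.
  have dV : is_derive t (1 : R) (fun s : R => s^-1) (- t ^- 2).
    apply: DeriveDef; first exact: derivableV.
    by rewrite deriveV// derive_id scaler1.
  have dX : is_derive t (1 : R) (fun s : R => s^-1 ^+ k) (k%:R * t^-1 ^+ k.-1 * (- t ^- 2)).
    rewrite (_ : (fun s : R => _) = (fun s : R => s^-1) ^+ k); last by rewrite exprfctE.
    apply: (is_derive_eq (is_deriveX k dV)).
    by rewrite /GRing.scale /= mulr_natl.
  have dE : is_derive t (1 : R) (fun s : R => expR (- s^-1)) (t ^- 2 * expR (- t^-1)).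
    have dN : is_derive t (1 : R) (fun s : R => - s^-1) (t ^- 2).
      by apply: (is_derive_eq (is_deriveN dV)); rewrite opprK.
    have := @is_derive1_comp R expR (fun s : R => - s^-1) t _ _ (is_derive_expR _) dN.
    by move=> H; apply: is_derive_eq H _; rewrite mulrC.
  apply: is_derive_eq (is_deriveM dX dE) _.
  rewrite /flat t0 /GRing.scale /= -exprVn.
  case: (k) => [|l] /=; first by rewrite !mul0r expr0 mul1r mulr0 addr0 subr0.
  rewrite !exprS; ring.
- have nt : \forall s \near t, cst 0 s = flat k s.
    by near=> s; rewrite flat_eq0//; apply: ltW; near: s; exact: lt_nbhsl.
  apply: near_eq_is_derive nt _.
  by rewrite !flat_eq0 ?(ltW t0)// mulr0 subr0; exact: is_derive_cst.
- rewrite !flat_eq0// mulr0 subr0.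
  (* At 0 the difference quotient of [flat k] is [flat k.+1], which tends to 0. *)
  have H : h^-1 *: (flat k (h *: (1 : R) + 0) - flat k 0) @[h --> 0^'] --> (0 : R).
    have c : flat k.+1 h @[h --> 0^'] --> (0 : R) by
      move=> A /(@flat_cvg0 k.+1) /nbhs_dnbhs.
    apply: (cvg_trans _ c).
    apply: near_eq_cvg; near=> h.
    rewrite (flat_eq0 k (lexx 0)) subr0 addr0 /GRing.scale /= mulr1.
    by rewrite /flat; case: ifP => _; rewrite ?mulr0// mulrA -exprS.
  apply: DeriveDef; first by apply/cvg_ex; exists 0; exact: H.
  exact/cvg_lim/H.
Unshelve. all: by end_near. Qed.

Context (n : nat).

Lemma Ck_on_flat j k (D : set 'rV[R]_n) (f : 'rV[R]_n -> R^o) :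
  open D -> Ck_on j D f -> Ck_on j D (fun p => flat k (f p) : R^o).
Proof.
move=> oD; elim: j k => [|j IH] k.
  move=> cf p Dp; apply: (continuous_comp (cf p Dp)).
  apply: differentiable_continuous; apply/derivable1_diffP.
  by have [] := is_derive_flat k (f p).
move=> Cf1; have := Cf1; move=> [df Cf].
have dflat t : differentiable (flat k : R^o -> R^o) t.
  by apply/derivable1_diffP; have [] := is_derive_flat k t.
split=> [p Dp|v]; first exact: (differentiable_comp (df p Dp) (dflat (f p))).
have C2 := Ck_onM oD (IH k.+2 (Ck_onW Cf1)) (Cf v).
have C1 := Ck_onM oD (Ck_on_cst j D (- k%:R)) (Ck_onM oD (IH k.+1 (Ck_onW Cf1)) (Cf v)).
apply: Ck_on_ext oD _ (Ck_onD oD C2 C1) => p; rewrite inE => Dp /=.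
apply/esym/(etrans (diff_comp_at v (df p Dp) (dflat (f p)))).
have [dk1 dk2] := is_derive_flat k (f p).
rewrite diff1E// derive1E dk2 /GRing.scale /=; ring.
Qed.


Lemma Ck_on_sum j (D : set 'rV[R]_n) (I : Type) (r : seq I) (P : pred I)
    (f : I -> 'rV[R]_n -> R^o) :
  open D -> (forall i, P i -> Ck_on j D (f i)) ->
  Ck_on j D (fun p => \sum_(i <- r | P i) f i p : R^o).
Proof.
move=> oD Cf; elim: r => [|i r IH].
  apply: Ck_on_ext oD _ (Ck_on_cst j D 0) => p _.
  by rewrite big_nil.
case Pi: (P i); last by apply: Ck_on_ext oD _ IH => p _; rewrite big_cons Pi.
by apply: Ck_on_ext oD _ (Ck_onD oD (Cf i Pi) IH) => p _; rewrite big_cons Pi.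
Qed.

Lemma Ck_on_coord j (D : set 'rV[R]_n) i : Ck_on j D (fun p => p 0 i : R^o).
Proof.
have @c : {linear 'rV[R]_n -> R^o}.
  by exists (fun N : 'rV[R]_n => N 0 i); do 2![eexists]; do ?[constructor];
     rewrite ?mxE// => ? *; rewrite ?mxE//; move=> ?; rewrite !mxE.
have cc : continuous c by exact: coord_continuous.
exact: Ck_on_linear cc.
Qed.

(** The standard quotient flat(r^2 - q) / (flat(r^2 - q) + flat(q - s)), with q the squared
    Euclidean distance to [p0]: the ambient sup norm is not smooth, while q is a polynomial. The
    compact set is a closed cube, which contains every point with q < r^2. *)
Lemma bump_exists (p0 : 'rV[R]_n) (U : set 'rV[R]_n) : nbhs p0 U ->
  exists (chi : 'rV[R]_n -> R^o) (K : set 'rV[R]_n),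
  [/\ compact K, K `<=` U, forall p, ~ K p -> chi p = 0,
      {near p0, chi =1 cst 1} & Coo_on setT chi].
Proof.
move=> /nbhs_ballP[e /= e0 eU].
pose r := e / 2; have r0 : 0 < r by rewrite divr_gt0.
pose K := [set p : 'rV[R]_n | forall i, `[p0 0 i - r, p0 0 i + r]%classic (p 0 i)].
pose q (p : 'rV[R]_n) : R^o := \sum_(i < n) (p 0 i - p0 0 i) * (p 0 i - p0 0 i).
(* Since 0 < s < r^2, at each point one of q < r^2 and q > s holds, so the denominator never
   vanishes; where q < s its second term is 0 and the quotient is 1. *)
pose s := r ^+ 2 / 2; have s0 : 0 < s by rewrite divr_gt0// exprn_gt0.
pose a p : R^o := r ^+ 2 + - q p.
pose b p : R^o := q p + - s.
pose d p : R^o := flat 0 (a p) + flat 0 (b p).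
have d0 p : 0 < d p.
  rewrite /d; have [qs|qs] := ltP (q p) (r ^+ 2).
    by rewrite ltr_pwDl// ?flat_ge0// flat_gt0// subr_gt0.
  rewrite ltr_wpDl// ?flat_ge0// flat_gt0// subr_gt0; apply: lt_le_trans qs.
  by rewrite /s ltr_pdivrMr// ltr_pMr ?exprn_gt0// ltr1n.
have Cq k : Ck_on k setT q.
  apply: Ck_on_sum => [|i _]; first exact: openT.
  have C1 : Ck_on k setT (fun p : 'rV[R]_n => p 0 i - p0 0 i : R^o).
    by apply: (Ck_onD openT); [exact: Ck_on_coord|exact: (Ck_on_cst _ _ (- p0 0 i))].
  exact: (Ck_onM openT C1 C1).
have Ca k : Ck_on k setT a.
  by apply: (Ck_onD openT); [exact: Ck_on_cst|exact: (Ck_onN openT)].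
have Cb k : Ck_on k setT b.
  by apply: (Ck_onD openT); [exact: Cq|exact: (Ck_on_cst _ _ (- s))].
have Cd k : Ck_on k setT d by apply: (Ck_onD openT); apply: Ck_on_flat openT _.
exists (fun p => flat 0 (a p) * (d p)^-1), K; split.
- apply: (@rV_compact R n (fun i => `[p0 0 i - r, p0 0 i + r]%classic)) => i.
  exact: segment_compact.
- move=> p Kp; apply: eU; split=> // i j; rewrite (ord1 i) /ball /= ltr_distlC.
  have := Kp j; rewrite /= in_itv /= => /andP[h1 h2].
  have re : r < e by rewrite /r ltr_pdivrMr// ltr_pMr// ltr1n.
  apply/andP; split; first by apply: lt_le_trans h1; rewrite ltrD2l ltrN2.
  by apply: le_lt_trans h2 _; rewrite ltrD2l.
- move=> p Kp; rewrite flat_eq0 ?mul0r// subr_le0 leNgt; apply/negP => qr; apply: Kp => i.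
  rewrite /= in_itv /= -ler_distlC -(@ler_pXn2r _ 2)// ?nnegrE ?ltW//.
  apply: le_lt_trans qr; rewrite /q (bigD1 i)//= -normrX ger0_norm ?sqr_ge0//.
  rewrite -expr2 -[leLHS]addr0 lerD//; last by rewrite sumr_ge0// => l _; rewrite -expr2 sqr_ge0.
  by rewrite -sqrrN opprB.
- have qs : \forall p \near p0, q p < s.
    have cq : {for p0, continuous q} by exact: (Cq 0%N).
    have : q p0 < s by rewrite /q big1 // => i _; rewrite subrr mul0r.
    by move=> qs; have := cq _ (lt_nbhsl qs).
  apply: filterS qs => p qs /=; rewrite /d (@flat_eq0 0 (b p)); last by rewrite subr_le0 ltW.
  rewrite addr0 divff// gt_eqF// flat_gt0// subr_gt0; apply: lt_trans qs _.
  by rewrite /s ltr_pdivrMr// ltr_pMr ?exprn_gt0// ltr1n.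
- move=> k; apply: (Ck_onM openT); first exact: (Ck_on_flat 0 openT (Ca k)).
  by apply: (Ck_onV openT) => // p _; rewrite gt_eqF.
Qed.

End Bump.

(** * Germs of functions on a manifold *)

Section CkAt.
Context (R : realType) (n : nat).
Implicit Types (f g : 'rV[R]_n -> R^o) (p : 'rV[R]_n).

Definition Ck_at k p f := exists2 D, nbhs p D & Ck_on k D f.

Lemma Ck_at_open k p f : Ck_at k p f -> exists D, [/\ open D, D p & Ck_on k D f].
Proof.
move=> [D nD Cf]; exists D°; split; [exact: open_interior|exact: nD|].
exact: Ck_on_sub (@interior_subset _ D) Cf.
Qed.

Lemma Ck_at_openI k p f g : Ck_at k p f -> Ck_at k p g ->
  exists D, [/\ open D, D p, Ck_on k D f & Ck_on k D g].
Proof.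
move=> /Ck_at_open[D [oD Dp Cf]] /Ck_at_open[D' [oD' D'p Cg]].
exists (D `&` D'); split; [exact: openI|by []| |].
- exact: Ck_on_sub (@subIsetl _ D D') Cf.
- exact: Ck_on_sub (@subIsetr _ D D') Cg.
Qed.

Lemma open_Ck_at k p D f : open D -> D p -> Ck_on k D f -> Ck_at k p f.
Proof. by move=> oD Dp Cf; exists D => //; exact: open_nbhs_nbhs. Qed.

Lemma Ck_on_at k D f : (forall p, D p -> Ck_at k p f) -> Ck_on k D f.
Proof.
move=> H; apply: Ck_on_bigcup => p /H[D' /nbhs_singleton D'p Cf].
by exists D'.
Qed.

Lemma Ck_at_ext k p f g : {near p, f =1 g} -> Ck_at k p f -> Ck_at k p g.
Proof.
move=> fg [D nD Cf].
pose D' := (D `&` [set q | f q = g q])°.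
have nD' : nbhs p (D `&` [set q | f q = g q]) by exact: filterI.
apply: (@open_Ck_at _ _ D'); [exact: open_interior|exact: nD'|].
apply: (@Ck_on_ext _ _ _ _ f); [exact: open_interior| |].
  by move=> q; rewrite inE => /interior_subset[].
by apply: Ck_on_sub Cf => q /interior_subset[].
Qed.

Lemma Ck_at_leq k l p f : (k <= l)%N -> Ck_at l p f -> Ck_at k p f.
Proof. by move=> kl [D nD Cf]; exists D => //; exact: Ck_on_leq Cf. Qed.

Lemma Ck_at_cst k p (a : R) : Ck_at k p (cst a : _ -> R^o).
Proof. by exists setT; [exact: filterT|exact: Ck_on_cst]. Qed.

Lemma Ck_at_coord k p i : Ck_at k p (fun p => p 0 i : R^o).
Proof. by exists setT; [exact: filterT|exact: Ck_on_coord]. Qed.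

Lemma Ck_atD k p f g : Ck_at k p f -> Ck_at k p g -> Ck_at k p (f \+ g).
Proof.
move=> Cf /(Ck_at_openI Cf)[D [oD Dp {}Cf Cg]].
by apply: (open_Ck_at oD Dp); exact: Ck_onD.
Qed.

Lemma Ck_atM k p f g : Ck_at k p f -> Ck_at k p g ->
  Ck_at k p (fun p => f p * g p : R^o).
Proof.
move=> Cf /(Ck_at_openI Cf)[D [oD Dp {}Cf Cg]].
by apply: (open_Ck_at oD Dp); exact: Ck_onM.
Qed.

Lemma Ck_at_sum k p (I : Type) (r : seq I) (f : I -> 'rV[R]_n -> R^o) :
  (forall i, Ck_at k p (f i)) ->
  Ck_at k p (fun p => \sum_(i <- r) f i p : R^o).
Proof.
move=> Cf; elim: r => [|i r IH].
  rewrite (_ : (fun _ => _) = cst 0); first exact: Ck_at_cst.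
  by apply/funext => q; rewrite big_nil.
rewrite (_ : (fun _ => _) = f i \+ (fun p => \sum_(j <- r) f j p)).
  exact: Ck_atD (Cf i) IH.
by apply/funext => q; rewrite big_cons.
Qed.

Lemma Ck_at_continuous k p f : Ck_at k p f -> {for p, continuous f}.
Proof.
by move=> /(Ck_at_leq (leq0n k))[D /nbhs_singleton Dp]; apply.
Qed.

Lemma Ck_atV k p f : f p != 0 -> Ck_at k p f -> Ck_at k p (fun p => (f p)^-1 : R^o).
Proof.
move=> f0 Cf; have cf := Ck_at_continuous Cf.
have nf : \forall q \near p, f q != 0.
  have : \forall y \near f p, y != 0 by exact: open_neq.
  exact: cf.
have [D [oD Dp Cf1]] := Ck_at_open Cf.
pose D' := [set q | f q != 0]°.
apply: (@open_Ck_at _ _ (D `&` D')); first exact: openI oD (open_interior _).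
  by split.
apply: Ck_onV; first exact: openI oD (open_interior _).
  by move=> q [_ /interior_subset].
exact: Ck_on_sub (@subIsetl _ _ _) Cf1.
Qed.

Lemma Ck_at_differentiable k p f : Ck_at k.+1 p f -> differentiable f p.
Proof. by move=> [D /nbhs_singleton Dp [df _]]; exact: df. Qed.

Lemma Ck_at_diff k p f v : Ck_at k.+1 p f -> Ck_at k p (fun q => 'd f q v).
Proof. by move=> [D nD [_ Cf]]; exists D => //; exact: Cf. Qed.

Lemma Ck_at_near k p f : Ck_at k p f -> \forall q \near p, Ck_at k q f.
Proof.
move=> /Ck_at_open[D [oD Dp Cf]].
by apply: filterS (open_nbhs_nbhs (conj oD Dp)) => q Dq; exact: open_Ck_at oD Dq Cf.
Qed.

End CkAt.

Lemma Ck_at_comp (R : realType) (n m k : nat) (p : 'rV[R]_n)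
    (F : 'rV[R]_n -> 'rV[R]_m) (g : 'rV[R]_m -> R^o) :
  (forall j, Ck_at k p (fun p => F p 0 j : R^o)) -> Ck_at k (F p) g ->
  Ck_at k p (g \o F).
Proof.
move=> CF [D' nD' Cg].
have cF : {for p, continuous F}.
  by apply: row_continuous_at => j; exact: Ck_at_continuous (CF j).
have /choice[D HD] : forall j, exists D : set 'rV[R]_n,
    nbhs p D /\ Ck_on k D (fun p => F p 0 j : R^o).
  by move=> j; have [D nD CD] := CF j; exists D.
have nD : \forall q \near p, forall j, D j q.
  exact: (@filter_forall _ _ D _ _ (fun j => (HD j).1)).
have nE : nbhs p ([set q | forall j, D j q] `&` F @^-1` D') by apply: filterI => //; exact: cF.
apply: open_Ck_at (open_interior _) nE _.
apply: Ck_on_comp (open_interior _) _ _ Cg.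
  by move=> j; have [_] := HD j; apply: Ck_on_sub => q /interior_subset[].
by move=> q /interior_subset[].
Qed.

Lemma hom_sum (R : realType) (n : nat) (W : vectType R) (alpha : 'Hom('rV[R]_n, W)) p :
  alpha p = \sum_i p 0 i *: alpha 'e_i.
Proof.
rewrite [in LHS](row_sum_delta p) linear_sum; apply: eq_bigr => i _.
by rewrite linearZ.
Qed.

Lemma Ck_at_hom (R : realType) (n k : nat) (alpha : 'Hom('rV[R]_n, R^o)) p :
  Ck_at k p alpha.
Proof.
rewrite (_ : fun_of_lfun alpha = fun q => \sum_i q 0 i * alpha 'e_i : R^o).
  apply: (@Ck_at_sum R n k p _ _ (fun i q => q 0 i * alpha 'e_i)) => i.
  exact: Ck_atM (Ck_at_coord k p i) (Ck_at_cst k p (alpha 'e_i)).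
by apply/funext => q; exact: hom_sum.
Qed.

Lemma diff_hom (R : realType) (n : nat) (alpha : 'Hom('rV[R]_n, R^o)) p v :
  'd alpha p v = alpha v.
Proof.
have c : continuous (fun_of_lfun alpha : {linear 'rV[R]_n -> R^o}).
  by move=> q; exact: Ck_at_continuous (Ck_at_hom 0 alpha q).
by have /(congr1 (@^~ v)) := diff_lin p c.
Qed.

(** * Functions read through a chart *)

Section ChartNear.
Context (R : realType) (n : nat) (X : topologicalType) (phi : chart R n X).
Hypothesis phiP : chart_axiom phi.

Lemma chart_near x (U : set X) : cdom phi x -> nbhs x U ->
  \forall p \near cfwd phi x,
    [/\ cdom phi (cbwd phi p), U (cbwd phi p) & cfwd phi (cbwd phi p) = p].
Proof.
have [oD oI bK cf cb] := phiP.
move=> Dx nU.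
have n1 : \forall p \near cfwd phi x, U (cbwd phi p).
  by apply: (cb x Dx); rewrite bK.
have n2 : nbhs (cfwd phi x) (cfwd phi @` cdom phi).
  by apply: open_nbhs_nbhs; split => //; exists x.
near=> p.
have : U (cbwd phi p) by near: p.
have [y Dy <-] : (cfwd phi @` cdom phi) p by near: p.
by rewrite bK.
Unshelve. all: by end_near. Qed.

Lemma chart_image_nbhs x (U : set X) : cdom phi x -> nbhs x U ->
  nbhs (cfwd phi x) (cfwd phi @` (cdom phi `&` U)).
Proof.
move=> Dx nU; apply: filterS (chart_near Dx nU) => p [Dp Up pE].
by exists (cbwd phi p).
Qed.

Lemma Ck_on_chart k (D : set X) f :
  (forall x, cdom phi x -> D x -> Ck_at k (cfwd phi x) f) ->
  Ck_on k (cfwd phi @` (cdom phi `&` D)) f.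
Proof. by move=> Cf; apply: Ck_on_at => _ [x [px Dx] <-]; exact: Cf. Qed.

Lemma chart_Ck_at k (D : set X) f x : cdom phi x -> nbhs x D ->
  Ck_on k (cfwd phi @` (cdom phi `&` D)) f -> Ck_at k (cfwd phi x) f.
Proof.
move=> px nD Cf; exists (cfwd phi @` (cdom phi `&` D)) => //.
exact: chart_image_nbhs.
Qed.

End ChartNear.

Section Germs.
Context (R : realType) (n : nat) (X : manifoldType R n).
Local Notation atlasX := (@atlas R n X).
Implicit Types (f g : X -> R) (x : X) (phi : chart R n X).

Lemma chart_at_atlas x : atlasX (chart_at x).
Proof. by rewrite /chart_at; case: cid2. Qed.

Lemma chart_at_dom x : cdom (chart_at x) x.
Proof. by rewrite /chart_at; case: cid2. Qed.

Lemma atlas_axiom phi : atlasX phi -> chart_axiom phi.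
Proof. exact: atlas_chart. Qed.

Lemma chart_nbhs phi x : atlasX phi -> cdom phi x -> nbhs x (cdom phi).
Proof.
by move=> aphi px; apply: open_nbhs_nbhs; split=> //; have [] := atlas_axiom aphi.
Qed.

Definition Ck_germ k x f := forall phi, atlasX phi -> cdom phi x ->
  Ck_at k (cfwd phi x) (f \o cbwd phi : _ -> R^o).

(** One chart suffices: in any other chart the coordinate expression is, near the point, the given
    one composed with a transition map, which is smooth by compatibility. *)
Lemma chart_Ck_germ k x f phi : atlasX phi -> cdom phi x ->
  Ck_at k (cfwd phi x) (f \o cbwd phi : _ -> R^o) -> Ck_germ k x f.
Proof.
move=> aphi px Cf psi apsi qx.
have [_ _ phiK _ _] := atlas_axiom aphi.
have [oD _ psiK _ _] := atlas_axiom apsi.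
apply: (@Ck_at_ext _ _ _ _ ((f \o cbwd phi) \o (cfwd phi \o cbwd psi))).
  apply: filterS (chart_near (atlas_axiom apsi) qx (chart_nbhs aphi px)) => p [_ pp _] /=.
  by rewrite phiK.
apply: Ck_at_comp; last by rewrite /= psiK.
move=> j; apply: (chart_Ck_at (atlas_axiom apsi) qx (chart_nbhs aphi px)).
exact: atlas_compatible.
Qed.

Lemma Ck_germP k x f :
  Ck_germ k x f <-> Ck_at k (cfwd (chart_at x) x) (f \o cbwd (chart_at x) : _ -> R^o).
Proof.
split; first by apply; [exact: chart_at_atlas|exact: chart_at_dom].
exact: chart_Ck_germ (chart_at_atlas x) (chart_at_dom x).
Qed.

Lemma Ck_funP k f : Ck_fun k f <-> forall x, Ck_germ k x f.
Proof.
split=> [Cf x phi aphi px|Cf phi aphi].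
  apply: (chart_Ck_at (atlas_axiom aphi) px filterT).
  by rewrite setIT; exact: Cf.
by rewrite -(setIT (cdom phi)); apply: Ck_on_chart => x px _; exact: Cf.
Qed.

Lemma near_chart_eq f g phi x : atlasX phi -> cdom phi x -> {near x, f =1 g} ->
  {near cfwd phi x, f \o cbwd phi =1 g \o cbwd phi}.
Proof.
move=> aphi px fg.
by apply: filterS (chart_near (atlas_axiom aphi) px fg) => p [].
Qed.

Lemma Ck_germ_ext k x f g : {near x, f =1 g} -> Ck_germ k x f -> Ck_germ k x g.
Proof.
by move=> fg Cf phi aphi px; apply: Ck_at_ext (near_chart_eq aphi px fg) (Cf _ aphi px).
Qed.

Lemma Ck_germ_leq k l x f : (k <= l)%N -> Ck_germ l x f -> Ck_germ k x f.
Proof. by move=> kl Cf phi aphi px; exact: Ck_at_leq kl (Cf _ aphi px). Qed.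

Lemma Ck_germ_cst k x (a : R) : Ck_germ k x (cst a).
Proof. by move=> phi _ _; exact: Ck_at_cst. Qed.

Lemma Ck_germD k x f g : Ck_germ k x f -> Ck_germ k x g -> Ck_germ k x (f \+ g).
Proof. by move=> Cf Cg phi aphi px; exact: Ck_atD (Cf _ aphi px) (Cg _ aphi px). Qed.

Lemma Ck_germM k x f g : Ck_germ k x f -> Ck_germ k x g -> Ck_germ k x (f \* g).
Proof. by move=> Cf Cg phi aphi px; exact: Ck_atM (Cf _ aphi px) (Cg _ aphi px). Qed.

Lemma Ck_germZ k x a f : Ck_germ k x f -> Ck_germ k x (fun y => a * f y).
Proof. exact: Ck_germM (Ck_germ_cst k a). Qed.

Lemma Ck_germB k x f g : Ck_germ k x f -> Ck_germ k x g -> Ck_germ k x (f \- g).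
Proof.
move=> Cf Cg; rewrite (_ : f \- g = f \+ (fun y => -1 * g y)).
  exact/(Ck_germD Cf)/Ck_germZ.
by apply/funext => y /=; rewrite mulN1r.
Qed.

Lemma Ck_germ_sum k x (I : Type) (r : seq I) (f : I -> X -> R) :
  (forall i, Ck_germ k x (f i)) -> Ck_germ k x (fun y => \sum_(i <- r) f i y).
Proof.
move=> Cf phi aphi px.
exact: (@Ck_at_sum R n k _ I r (fun i => f i \o cbwd phi) (fun i => Cf i phi aphi px)).
Qed.

Lemma Ck_germ_prod k x (I : Type) (r : seq I) (f : I -> X -> R) :
  (forall i, Ck_germ k x (f i)) -> Ck_germ k x (fun y => \prod_(i <- r) f i y).
Proof.
move=> Cf; elim: r => [|i r IH].
  rewrite (_ : (fun _ => _) = cst 1); first exact: Ck_germ_cst.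
  by apply/funext => q; rewrite big_nil.
rewrite (_ : (fun _ => _) = f i \* (fun p => \prod_(j <- r) f j p)).
  exact: Ck_germM (Cf i) IH.
by apply/funext => q; rewrite big_cons.
Qed.

Lemma Ck_germV k x f : f x != 0 -> Ck_germ k x f -> Ck_germ k x (fun y => (f y)^-1).
Proof.
move=> f0 Cf phi aphi px.
have [_ _ phiK _ _] := atlas_axiom aphi.
by apply: (@Ck_atV _ _ _ _ (f \o cbwd phi)) (Cf _ aphi px); rewrite /= phiK.
Qed.

Lemma smooth_funP f : smooth_fun f <-> forall x k, Ck_germ k x f.
Proof.
by split=> [sf x k|Cf k]; [move: x; exact/Ck_funP/sf|apply/Ck_funP => x; exact: Cf].
Qed.

Lemma Ck_germ_continuous k x f : Ck_germ k x f -> {for x, continuous f}.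
Proof.
move=> /Ck_germP Cf; have [_ _ phiK cf _] := atlas_axiom (chart_at_atlas x).
have cx := chart_at_dom x.
apply: (cvg_trans _ (_ : (f \o cbwd (chart_at x)) \o cfwd (chart_at x) @ x --> f x)).
  apply: near_eq_cvg; apply: filterS (chart_nbhs (chart_at_atlas x) cx) => y cy /=.
  by rewrite phiK.
rewrite -[X in _ --> f X](phiK x cx).
apply: (continuous_comp (cf x cx)); exact: Ck_at_continuous Cf.
Qed.

Lemma Ck_germ_coord k x phi j : atlasX phi -> cdom phi x ->
  Ck_germ k x (fun y => cfwd phi y 0 j).
Proof.
move=> aphi px; apply: (chart_Ck_germ aphi px).
apply: Ck_at_ext (Ck_at_coord k _ j).
apply: filterS (chart_near (atlas_axiom aphi) px (chart_nbhs aphi px)) => p [_ _ pE] /=.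
by rewrite pE.
Qed.

(** Multiply f by a bump function read in the chart and extend by 0. Operators and [symbol_spec] act
    on global functions only, so this is how local constructions reach them. *)
Lemma germ_extension phi x f : atlasX phi -> cdom phi x ->
  (forall y, cdom phi y -> forall k, Ck_germ k y f) ->
  exists2 g, smooth_fun g & {near x, f =1 g}.
Proof.
move=> aphi px Cf.
have [oD oI phiK cfw cbw] := atlas_axiom aphi.
have nI : nbhs (cfwd phi x) (cfwd phi @` cdom phi).
  by apply: open_nbhs_nbhs; split => //; exists x.
have [chi [K [cK KI chi0 chi1 Cchi]]] := bump_exists nI.
pose g y := if `[< cdom phi y >] then f y * chi (cfwd phi y) else 0.
have gE y : cdom phi y -> g y = f y * chi (cfwd phi y).
  by move=> py; rewrite /g asboolT.
(* The Hausdorff property enters here: the compact support, closed in the chart image, must also be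
   closed in the whole manifold for the extension by 0 to be smooth. *)
have clK : closed (cbwd phi @` K).
  apply: compact_closed; first exact: (@manifold_hausdorff R n X).
  apply: continuous_compact cK; apply: continuous_in_subspaceT => p.
  by rewrite inE => /KI[y py <-]; exact: cbw.
exists g.
  move=> k; apply/Ck_funP => y; have [py|py] := pselect (cdom phi y).
    apply: (@Ck_germ_ext k y (f \* (chi \o cfwd phi))).
      by apply: filterS (chart_nbhs aphi py) => z pz; rewrite gE.
    apply: Ck_germM; first exact: Cf.
    apply: (chart_Ck_germ aphi py); apply: (@Ck_at_ext _ _ _ _ chi).
      apply: filterS (chart_near (atlas_axiom aphi) py (chart_nbhs aphi py)) => p [_ _ pE] /=.
      by rewrite pE.
    by exists setT; [exact: filterT|exact: Cchi].
  apply: (@Ck_germ_ext k y (cst 0)); last exact: Ck_germ_cst.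
  have : nbhs y (~` (cbwd phi @` K)).
    apply: open_nbhs_nbhs; split; first exact: closed_openC.
    by move=> [p /KI[z pz <-]]; rewrite phiK// => zy; rewrite -zy in py.
  apply: filterS => z Kz; rewrite /g; case: asboolP => //= pz.
  by rewrite chi0 ?mulr0// => Kp; apply: Kz; exists (cfwd phi z) => //; exact: phiK.
have n1 : \forall y \near x, chi (cfwd phi y) = 1 by exact: (cfw x px _ chi1).
near=> y; have py : cdom phi y by near: y; exact: chart_nbhs.
rewrite gE//; have -> : chi (cfwd phi y) = 1 by near: y.
by rewrite mulr1.
Unshelve. all: by end_near. Qed.

End Germs.

(** * Differentials and smooth maps *)

Section Differentials.
Context (R : realType) (n : nat) (X : manifoldType R n).
Local Notation atlasX := (@atlas R n X).
Implicit Types (f g : X -> R) (x : X) (phi : chart R n X).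

Lemma dfunE f x v :
  dfun f x v = 'd (f \o cbwd (chart_at x) : _ -> R^o) (cfwd (chart_at x) x) v.
Proof. by rewrite /dfun lfunE. Qed.

Lemma tcoordE phi x v :
  tcoord phi x v = 'd (cfwd phi \o cbwd (chart_at x)) (cfwd (chart_at x) x) v.
Proof. by rewrite /tcoord lfunE. Qed.

Lemma dfun_ext f g x : {near x, f =1 g} -> Ck_germ 1 x f -> dfun g x = dfun f x.
Proof.
move=> fg Cf; have df := Ck_at_differentiable ((Ck_germP 1 x f).1 Cf).
apply/lfunP => v; apply: (etrans (dfunE g x v)); apply: (etrans _ (esym (dfunE f x v))).
by apply: near_eq_diff_at df; exact: near_chart_eq (chart_at_atlas x) (chart_at_dom x) fg.
Qed.

(** The covector composed with the chart is a local function with the right differential; it is then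
    extended. Identities that [symbol_spec] states for differentials thereby hold for all
    covectors. *)
Lemma dfun_surj x (alpha : 'Hom('rV[R]_n, R^o)) :
  exists2 f, smooth_fun f & dfun f x = alpha.
Proof.
pose phi := chart_at x; pose f0 := alpha \o cfwd phi.
have ax := chart_at_atlas x; have px := chart_at_dom x.
have E y : cdom phi y -> {near cfwd phi y, alpha =1 f0 \o cbwd phi}.
  move=> py.
  apply: filterS (chart_near (atlas_axiom ax) py (chart_nbhs ax py)) => p [_ _ pE] /=.
  by rewrite /f0 /= pE.
have C0 y : cdom phi y -> forall k, Ck_germ k y f0.
  move=> py k; apply: (chart_Ck_germ ax py); apply: (Ck_at_ext (E y py)).
  exact: Ck_at_hom.
have [g sg fg] := germ_extension ax px C0.
exists g => //; rewrite (dfun_ext fg (C0 x px 1%N)); apply/lfunP => v; rewrite dfunE.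
rewrite (near_eq_diff_at v (E x px) (Ck_at_differentiable (Ck_at_hom 1 alpha _))).
exact: diff_hom.
Qed.

Lemma chart_coord_differentiable phi x : atlasX phi -> cdom phi x ->
  differentiable (cfwd phi \o cbwd (chart_at x)) (cfwd (chart_at x) x).
Proof.
move=> aphi px; apply: row_differentiable => j.
exact: Ck_at_differentiable ((Ck_germP _ _ _).1 (Ck_germ_coord 1 j aphi px)).
Qed.

Lemma tcoord_dfun phi x v j : atlasX phi -> cdom phi x ->
  tcoord phi x v 0 j = dfun (fun y => cfwd phi y 0 j) x v.
Proof.
move=> aphi px; rewrite tcoordE dfunE.
exact: diff_coord (chart_coord_differentiable aphi px).
Qed.

Lemma dfun_chart phi x f v : atlasX phi -> cdom phi x -> Ck_germ 1 x f ->
  dfun f x v = 'd (f \o cbwd phi : _ -> R^o) (cfwd phi x) (tcoord phi x v).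
Proof.
move=> aphi px Cf; rewrite dfunE tcoordE.
have [_ _ phiK _ _] := atlas_axiom aphi.
have [_ _ psiK _ _] := atlas_axiom (chart_at_atlas x).
have dF := chart_coord_differentiable aphi px.
have E : (cfwd phi \o cbwd (chart_at x)) (cfwd (chart_at x) x) = cfwd phi x.
  by rewrite /= psiK//; exact: chart_at_dom.
apply: (diff_comp_near v E _ dF); last exact: Ck_at_differentiable (Cf _ aphi px).
apply: filterS (chart_near (atlas_axiom (chart_at_atlas x)) (chart_at_dom x)
  (chart_nbhs aphi px)) => p [_ pp _] /=.
by rewrite phiK.
Qed.

(** Removes the chosen charts from the notion of smooth vector field. One direction is the chain
    rule in a fixed chart; the other takes for g a global extension of each coordinate function. *)
Lemma smooth_vfield_dfun (D : set X) (V : X -> 'rV[R]_n) : open D ->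
  smooth_vfield D V <->
  forall g, smooth_fun g -> forall x, D x -> forall k, Ck_germ k x (fun y => dfun g y (V y)).
Proof.
move=> oD; split=> [sV g sg x Dx k|H phi aphi j k].
  have aphi := chart_at_atlas x; have px := chart_at_dom x.
  set phi := chart_at x in aphi px *.
  have nD : nbhs x D by exact: open_nbhs_nbhs.
  have Cg l y : Ck_germ l y g by apply: (smooth_funP g).1.
  apply: (chart_Ck_germ aphi px).
  pose F p := \sum_(i < n) tcoord phi (cbwd phi p) (V (cbwd phi p)) 0 i
              * 'd (g \o cbwd phi : _ -> R^o) p 'e_i.
  apply: (@Ck_at_ext _ _ _ _ (F : _ -> R^o)).
    apply: filterS (chart_near (atlas_axiom aphi) px (chart_nbhs aphi px)) => p [pp _ pE] /=.
    rewrite (dfun_chart _ aphi pp (Cg _ _)) pE /F.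
    rewrite [in RHS](row_sum_delta (tcoord _ _ _)) linear_sum; apply: eq_bigr => i _.
    by rewrite linearZ.
  apply: (@Ck_at_sum _ _ _ _ _ _ (fun i p => tcoord phi (cbwd phi p) (V (cbwd phi p)) 0 i
              * 'd (g \o cbwd phi : _ -> R^o) p 'e_i)) => i.
  apply: Ck_atM; last exact: Ck_at_diff (Cg k.+1 x _ aphi px).
  by apply: (chart_Ck_at (atlas_axiom aphi) px nD); exact: sV.
apply: Ck_on_chart => x px Dx.
have [g sg xg] := germ_extension aphi px (fun y py k => Ck_germ_coord k j aphi py).
have := H g sg x Dx k phi aphi px; apply: Ck_at_ext.
(* [dfun] at y depends on the germ at y, so the extension must agree with the coordinate near every
   y close to x, not only at these points. *)
have ng : \forall y \near x, {near y, (fun y => cfwd phi y 0 j) =1 g}.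
  exact: (@near_join X x _ xg).
apply: filterS (chart_near (atlas_axiom aphi) px ng) => p [pp pg _] /=.
rewrite (dfun_ext pg (Ck_germ_coord 1 j aphi pp)).
by rewrite tcoord_dfun.
Qed.

End Differentials.

(** * Smooth maps and pullback of functions *)

Section SmoothMaps.
Context (R : realType) (n m : nat) (X : manifoldType R n) (Y : manifoldType R m).
Implicit Types (f : X -> Y) (g : Y -> R) (x : X).

(** Smoothness is phrased by pulling back germs, since the projection, the translations and the
    local sections are used mainly through the functions composed with them. *)
Definition smooth_map_at f x := {for x, continuous f} /\
  forall k g, Ck_germ k (f x) g -> Ck_germ k x (g \o f).

Lemma smooth_map_coord f x : {for x, continuous f} ->
  (forall k j, Ck_at k (cfwd (chart_at x) x)
    (fun p => cfwd (chart_at (f x)) (f (cbwd (chart_at x) p)) 0 j : R^o)) ->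
  smooth_map_at f x.
Proof.
move=> cf Cf; split=> // k g Cg; apply/Ck_germP.
have ax := chart_at_atlas x; have px := chart_at_dom x.
have ay := chart_at_atlas (f x); have py := chart_at_dom (f x).
have [_ _ phiK _ _] := atlas_axiom ax.
have [_ _ psiK _ _] := atlas_axiom ay.
apply: (@Ck_at_ext _ _ _ _ ((g \o cbwd (chart_at (f x))) \o
  (fun p => cfwd (chart_at (f x)) (f (cbwd (chart_at x) p))))).
  have nf := cf _ (chart_nbhs ay py).
  apply: filterS (chart_near (atlas_axiom ax) px nf) => p [_ pp _] /=.
  by rewrite psiK.
by apply: Ck_at_comp => //; rewrite phiK//; exact: Cg.
Qed.

Lemma smooth_on_map_at (D : set X) f x : smooth_on (@atlas R n X) (@atlas R m Y) D f ->
  nbhs x D -> smooth_map_at f x.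
Proof.
move=> [cf Cf] nD; have Dx := nbhs_singleton nD.
have cfx := cf x Dx.
apply: (smooth_map_coord cfx) => k j.
apply: (chart_Ck_at (D := D `&` f @^-1` cdom (chart_at (f x)))
  (atlas_axiom (chart_at_atlas x)) (chart_at_dom x)).
  apply: filterI => //; apply: cfx; exact: chart_nbhs (chart_at_atlas _) (chart_at_dom _).
by rewrite setIA; apply: Cf; exact: chart_at_atlas.
Qed.

Lemma dfun_comp f g x : smooth_map_at f x -> Ck_germ 1 (f x) g ->
  dfun (g \o f) x = cotmap f x (dfun g (f x)).
Proof.
move=> [cf Cf] Cg; apply/lfunP => v; rewrite /cotmap comp_lfunE !dfunE /tmap lfunE.
have ax := chart_at_atlas x; have px := chart_at_dom x.
have ay := chart_at_atlas (f x); have py := chart_at_dom (f x).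
have [_ _ phiK _ _] := atlas_axiom ax.
have [_ _ psiK _ _] := atlas_axiom ay.
set F := cfwd (chart_at (f x)) \o f \o cbwd (chart_at x).
have dF : differentiable F (cfwd (chart_at x) x).
  apply: row_differentiable => j.
  exact: Ck_at_differentiable ((Ck_germP _ _ _).1 (Cf _ _ (Ck_germ_coord 1 j ay py))).
have E : F (cfwd (chart_at x) x) = cfwd (chart_at (f x)) (f x) by rewrite /F /= phiK.
apply: (diff_comp_near v E _ dF); last exact: Ck_at_differentiable (Cg _ ay py).
have nf := cf _ (chart_nbhs ay py).
apply: filterS (chart_near (atlas_axiom ax) px nf) => p [_ pp _] /=.
by rewrite psiK.
Qed.

End SmoothMaps.

(** * Existence and uniqueness of the symbol *)

Section Slices.
Context (R : realType) (n m : nat).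

(** The product carries an atlas but no manifold structure; the lemmas that read a function through
    one chart ask only for [chart_axiom]. *)
Lemma prod_chart_axiom (X Y : topologicalType) (phi : chart R n X) (psi : chart R m Y) :
  chart_axiom phi -> chart_axiom psi -> chart_axiom (prod_chart phi psi).
Proof.
move=> [oD oI phiK cf cb] [oD' oI' psiK cf' cb']; split.
- rewrite openE => -[x y] [/= px py]; rewrite /interior /=.
  by exists (cdom phi, cdom psi); [split; exact: open_nbhs_nbhs|].
- rewrite (_ : _ @` _ = lsubmx @^-1` (cfwd phi @` cdom phi) `&`
                        rsubmx @^-1` (cfwd psi @` cdom psi)).
    apply: openI; apply: open_comp => // p _.
      exact: continuous_lsubmx.
    exact: continuous_rsubmx.
  apply/seteqP; split=> [_ [[x y] [/= px py] <-]|p [[x px xE] [y py yE]]].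
    by split; [exists x; rewrite ?row_mxKl|exists y; rewrite ?row_mxKr].
  by exists (x, y) => //=; rewrite xE yE hsubmxK.
- by move=> [x y] [/= px py]; rewrite row_mxKl row_mxKr phiK// psiK.
- move=> [x y] [/= px py]; apply: row_continuous_at => j.
  case: (splitP j) => i ji.
    have -> : (fun z : X * Y => row_mx (cfwd phi z.1) (cfwd psi z.2) 0 j) =
              (fun p : 'rV[R]_n => p 0 i) \o (cfwd phi \o fst).
      apply/funext => z; rewrite (_ : j = lshift m i) ?row_mxEl//; exact: val_inj.
    apply: continuous_comp; last exact: coord_continuous.
    by apply: continuous_comp; [exact: cvg_fst|exact: cf].
  have -> : (fun z : X * Y => row_mx (cfwd phi z.1) (cfwd psi z.2) 0 j) =
            (fun p : 'rV[R]_m => p 0 i) \o (cfwd psi \o snd).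
    apply/funext => z; rewrite (_ : j = rshift n i) ?row_mxEr//; exact: val_inj.
  apply: continuous_comp; last exact: coord_continuous.
  by apply: continuous_comp; [exact: cvg_snd|exact: cf'].
- move=> [x y] [/= px py]; set q := row_mx _ _.
  have c1 : {for q, continuous (cbwd phi \o lsubmx)}.
    by apply: continuous_comp; [exact: continuous_lsubmx|rewrite row_mxKl; exact: cb].
  have c2 : {for q, continuous (cbwd psi \o rsubmx)}.
    by apply: continuous_comp; [exact: continuous_rsubmx|rewrite row_mxKr; exact: cb'].
  exact: cvg_pair c1 c2.
Qed.

(** In product coordinates the slice is the affine inclusion p |-> (p, c), with c the coordinates of
    a. It serves right translations by a fixed group element and the local sections of the
    bundle. *)
Lemma smooth_on_slice l (X : manifoldType R n) (Y : manifoldType R m)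
    (Z : manifoldType R l) (D : set (X * Y)) (F : X * Y -> Z) (x : X) (a : Y) :
  smooth_on (prod_atlas (@atlas R n X) (@atlas R m Y)) (@atlas R l Z) D F ->
  nbhs (x, a) D -> smooth_map_at (fun y => F (y, a)) x.
Proof.
move=> [cF CF] nD; have Dx := nbhs_singleton nD.
have cFx := cF _ Dx.
have cs : {for x, continuous (fun y : X => (y, a))}.
  by apply: cvg_pair; [exact: cvg_id|exact: cvg_cst].
have cf : {for x, continuous (fun y => F (y, a))}.
  by apply: (continuous_comp cs); exact: cFx.
apply: (smooth_map_coord cf) => k j.
set phi := chart_at x; set chi := chart_at a; set psi := chart_at (F (x, a)).
have [_ _ chiK _ _] := atlas_axiom (chart_at_atlas a).
pose c := cfwd chi a.
pose H (q : 'rV[R]_(n + m)) : R^o := cfwd psi (F (cbwd (prod_chart phi chi) q)) 0 j.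
have -> : (fun p => cfwd psi (F (cbwd phi p, a)) 0 j : R^o) = H \o (fun p => row_mx p c).
  apply/funext => p; rewrite /H /= row_mxKl row_mxKr /c chiK//.
  exact: chart_at_dom.
apply: Ck_at_comp.
  move=> i; case: (splitP i) => i' ii'.
    rewrite (_ : (fun _ => _) = (fun p : 'rV[R]_n => p 0 i')); first exact: Ck_at_coord.
    apply/funext => p; rewrite (_ : i = lshift m i') ?row_mxEl//; exact: val_inj.
  rewrite (_ : (fun _ => _) = cst (c 0 i')); first exact: Ck_at_cst.
  apply/funext => p; rewrite (_ : i = rshift n i') ?row_mxEr//; exact: val_inj.
have pa := prod_chart_axiom (atlas_axiom (chart_at_atlas x)) (atlas_axiom (chart_at_atlas a)).
apply: (@chart_Ck_at R _ _ (prod_chart phi chi) pa k (D `&` F @^-1` cdom psi) _ (x, a)).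
- by split; exact: chart_at_dom.
- by apply: filterI => //; apply: cFx; exact: chart_nbhs (chart_at_atlas _) (chart_at_dom _).
- rewrite setIA; apply: CF; last exact: chart_at_atlas.
  by exists phi, chi; split=> //; exact: chart_at_atlas.
Qed.

End Slices.

(** * Product rule of order two and the symbol in coordinates *)

Section Symbols.
Context (R : realType) (n : nat).

(** [second_order_operator] is written with directional derivatives, [Ck_on] with differentials;
    their agreement near p, and not just at p, allows a second derivative. *)
Lemma near_derive_diff (f : 'rV[R]_n -> R^o) p v : Ck_at 1 p f ->
  \forall q \near p, 'D_v f q = 'd f q v.
Proof.
move=> /Ck_at_near; apply: filterS => q Cf; apply: deriveE.
exact: Ck_at_differentiable Cf.
Qed.

Lemma Ck_at_derivable (f : 'rV[R]_n -> R^o) p v : Ck_at 1 p f -> derivable f p v.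
Proof. by move=> /Ck_at_differentiable df; exact: diff_derivable. Qed.

Lemma Ck_at_derive k (f : 'rV[R]_n -> R^o) p v : Ck_at k.+1 p f ->
  Ck_at k p ('D_v f : _ -> R^o).
Proof.
move=> Cf; apply: Ck_at_ext (Ck_at_diff v Cf).
have := near_derive_diff v (Ck_at_leq (ltn0Sn k) Cf).
by apply: filterS => q ->.
Qed.

Lemma deriveM_at (f g : 'rV[R]_n -> R^o) p v : Ck_at 1 p f -> Ck_at 1 p g ->
  'D_v (fun q => f q * g q : R^o) p = f p * 'D_v g p + g p * 'D_v f p.
Proof.
move=> /(@Ck_at_derivable _ _ v) df /(@Ck_at_derivable _ _ v) dg.
exact: (@deriveM R _ f g).
Qed.

Lemma derive2M (f g : 'rV[R]_n -> R^o) p u v : Ck_at 2 p f -> Ck_at 2 p g ->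
  'D_u ('D_v (fun q => f q * g q : R^o) : _ -> R^o) p =
    f p * 'D_u ('D_v g : _ -> R^o) p + 'D_v g p * 'D_u f p
    + (g p * 'D_u ('D_v f : _ -> R^o) p + 'D_v f p * 'D_u g p).
Proof.
move=> Cf Cg.
have Cf1 := Ck_at_leq (leqnSn 1) Cf; have Cg1 := Ck_at_leq (leqnSn 1) Cg.
pose Df : 'rV[R]_n -> R^o := 'D_v f; pose Dg : 'rV[R]_n -> R^o := 'D_v g.
have Cf' : Ck_at 1 p Df := Ck_at_derive v Cf.
have Cg' : Ck_at 1 p Dg := Ck_at_derive v Cg.
pose h1 : 'rV[R]_n -> R^o := fun q => f q * Dg q.
pose h2 : 'rV[R]_n -> R^o := fun q => g q * Df q.
have E : \forall q \near p, ('D_v (fun q => f q * g q : R^o) : _ -> R^o) q = (h1 \+ h2) q.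
  apply: filterS2 (Ck_at_near Cf1) (Ck_at_near Cg1) => q Cfq Cgq.
  exact: deriveM_at.
have dh1 : derivable h1 p u := @Ck_at_derivable _ _ u (Ck_atM Cf1 Cg').
have dh2 : derivable h2 p u := @Ck_at_derivable _ _ u (Ck_atM Cg1 Cf').
apply: (etrans (near_eq_derive u E)); apply: (etrans (deriveD dh1 dh2)).
by congr (_ + _); [exact: (deriveM_at u Cf1 Cg')|exact: (deriveM_at u Cg1 Cf')].
Qed.

(** The computation with derivatives abstracted to scalars: first order terms cancel, and of the
    second order ones only the cross terms survive. Exchanging indices in half of them produces the
    symmetrised coefficients, as [a] itself may be non-symmetric. *)
Lemma leibniz_symbol (a : 'I_n -> 'I_n -> R) (b F G FG : 'I_n -> R)
    (F2 G2 FG2 : 'I_n -> 'I_n -> R) (f g : R) :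
  (forall i j, FG2 i j = f * G2 i j + G j * F i + (g * F2 i j + F j * G i)) ->
  (forall i, FG i = f * G i + g * F i) ->
  \sum_i \sum_j (2^-1 * (a i j + a j i)) * (G j * F i) =
  2^-1 * (\sum_i \sum_j a i j * FG2 i j + \sum_i b i * FG i)
  - 2^-1 * (\sum_i \sum_j a i j * F2 i j + \sum_i b i * F i) * g
  - 2^-1 * f * (\sum_i \sum_j a i j * G2 i j + \sum_i b i * G i).
Proof.
move=> FG2E FGE.
have -> : \sum_i \sum_j (2^-1 * (a i j + a j i)) * (G j * F i) =
    2^-1 * (\sum_i \sum_j (a i j * (G j * F i + F j * G i))).
  transitivity (2^-1 * (\sum_i \sum_j a i j * (G j * F i) + \sum_i \sum_j a j i * (G j * F i))).
    rewrite -big_split mulr_sumr; apply: eq_bigr => i _ /=.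
    rewrite -big_split mulr_sumr; apply: eq_bigr => j _ /=.
    ring.
  congr (_ * _); rewrite [X in _ + X]exchange_big /= -big_split /=.
  apply: eq_bigr => i _; rewrite -big_split /=; apply: eq_bigr => j _.
  ring.
have -> : \sum_i \sum_j a i j * FG2 i j =
  f * (\sum_i \sum_j a i j * G2 i j) + g * (\sum_i \sum_j a i j * F2 i j) +
  (\sum_i \sum_j (a i j * (G j * F i + F j * G i))).
  rewrite !mulr_sumr -!big_split; apply: eq_bigr => i _ /=.
  rewrite !mulr_sumr -!big_split; apply: eq_bigr => j _ /=.
  by rewrite FG2E; ring.
have -> : \sum_i b i * FG i = f * (\sum_i b i * G i) + g * (\sum_i b i * F i).
  rewrite !mulr_sumr -!big_split; apply: eq_bigr => i _ /=.
  by rewrite FGE; ring.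
ring.
Qed.

Definition coord_hom (i : 'I_n) : 'Hom('rV[R]_n, R^o) :=
  linfun (fun v : 'rV[R]_n => v 0 i : R^o).

Lemma coord_homE i v : coord_hom i v = v 0 i.
Proof.
have @c : {linear 'rV[R]_n -> R^o}.
  by exists (fun N : 'rV[R]_n => N 0 i); do 2![eexists]; do ?[constructor];
     rewrite ?mxE// => ? *; rewrite ?mxE//; move=> ?; rewrite !mxE.
by rewrite /coord_hom (_ : (fun v => _) = c)// lfunE.
Qed.

Lemma hom_sep (v w : 'rV[R]_n) :
  (forall alpha : 'Hom('rV[R]_n, R^o), alpha v = alpha w) -> v = w.
Proof. by move=> H; apply/rowP => i; have := H (coord_hom i); rewrite !coord_homE. Qed.

Context (X : manifoldType R n).
Implicit Types (L : (X -> R) -> X -> R) (x : X).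

Lemma dfun_derive (f : X -> R) x v : Ck_germ 1 x f ->
  dfun f x v = 'D_v (f \o cbwd (chart_at x) : _ -> R^o) (cfwd (chart_at x) x).
Proof.
by move=> Cf; rewrite dfunE deriveE//; exact: Ck_at_differentiable ((Ck_germP _ _ _).1 Cf).
Qed.

Lemma symbol_exists L x : diffusion_operator L -> exists s, symbol_spec L x s.
Proof.
move=> [/(_ _ (chart_at_atlas x)) [a [b [c LE]]] _ L1].
have {}LE f Cf := LE f Cf x (chart_at_dom x).
(* Evaluate on the constant 1. A zero order term would contribute -c f g / 2 to the right side of
   [symbol_spec], which no pairing of differentials can match. *)
have cx : c x = 0.
  have C1 : Ck_fun 2 (cst 1 : X -> R) by apply/Ck_funP => y; exact: Ck_germ_cst.
  have := LE _ C1; rewrite L1 /= big1 ?add0r; last first.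
    move=> i _; rewrite big1// => j _.
    rewrite (_ : 'D__ _ = cst 0); first by rewrite derive_cst mulr0.
    by apply/funext => q; rewrite derive_cst.
  by rewrite big1 ?add0r ?mulr1// => i _; rewrite derive_cst mulr0.
pose S (alpha : 'Hom('rV[R]_n, R^o)) : 'rV[R]_n :=
  \row_i \sum_j (2^-1 * (a x i j + a x j i)) * alpha 'e_j.
have S_lin : linear S.
  move=> r al be; apply/rowP => i; rewrite !mxE mulr_sumr -big_split; apply: eq_bigr => j _.
  by rewrite lfunE /= lfunE /= /GRing.scale /=; ring.
pose SL : {linear 'Hom('rV[R]_n, R^o) -> 'rV[R]_n} :=
  HB.pack S (GRing.isLinear.Build _ _ _ _ S S_lin).
exists (linfun SL) => f g Cf Cg.
have Cfx := (Ck_funP _ _).1 Cf x; have Cgx := (Ck_funP _ _).1 Cg x.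
have Cfg : Ck_fun 2 (f \* g).
  apply/Ck_funP => y.
  exact: Ck_germM ((Ck_funP 2 f).1 Cf y) ((Ck_funP 2 g).1 Cg y).
set p := cfwd (chart_at x) x.
set f' : 'rV[R]_n -> R^o := f \o cbwd (chart_at x).
set g' : 'rV[R]_n -> R^o := g \o cbwd (chart_at x).
have C2f : Ck_at 2 p f' by exact/Ck_germP.
have C2g : Ck_at 2 p g' by exact/Ck_germP.
have C1f := Ck_at_leq (leqnSn 1) C2f; have C1g := Ck_at_leq (leqnSn 1) C2g.
have [_ _ phiK _ _] := atlas_axiom (chart_at_atlas x).
have fp : f x = f' p by rewrite /f' /= phiK//; exact: chart_at_dom.
have gp : g x = g' p by rewrite /g' /= phiK//; exact: chart_at_dom.
have dF i : dfun f x 'e_i = 'D_'e_i f' p := dfun_derive _ (Ck_germ_leq (leqnSn 1) Cfx).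
have dG i : dfun g x 'e_i = 'D_'e_i g' p := dfun_derive _ (Ck_germ_leq (leqnSn 1) Cgx).
have FG i := deriveM_at 'e_i C1f C1g.
have FG2 i j := derive2M 'e_i 'e_j C2f C2g.
have Lf := LE _ Cf; have Lg := LE _ Cg; have Lfg := LE _ Cfg.
rewrite {}Lf {}Lg {}Lfg cx !mul0r !addr0 /= -/f' -/g' -/p fp gp.
apply: etrans (leibniz_symbol (a x) (b x 0) FG2 FG).
have -> : linfun SL (dfun g x) = S (dfun g x) by rewrite lfunE.
rewrite (hom_sum (dfun f x)); apply: eq_bigr => i _.
rewrite dF /S mxE /GRing.scale /= mulr_suml; apply: eq_bigr => j _.
by rewrite dG mulrA.
Qed.

Lemma symbolP L x : (exists s, symbol_spec L x s) -> symbol_spec L x (symbol L x).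
Proof. by move=> H; rewrite /symbol; exact: (xgetPex 0 H). Qed.

(** The specification fixes all pairings of differentials; these exhaust the covectors, and
    covectors separate vectors. *)
Lemma symbol_spec_uniq L x s s' : symbol_spec L x s -> symbol_spec L x s' -> s = s'.
Proof.
move=> H H'; apply/lfunP => be; apply: hom_sep => al.
have [f sf <-] := dfun_surj x al; have [g sg <-] := dfun_surj x be.
by rewrite (H _ _ (sf _) (sg _)) (H' _ _ (sf _) (sg _)).
Qed.

Lemma symbol_eq L x s : symbol_spec L x s -> symbol L x = s.
Proof. by move=> H; apply: (symbol_spec_uniq (symbolP _) H); exists s. Qed.

Lemma symbol_spec_sym L x s (al be : 'Hom('rV[R]_n, R^o)) :
  symbol_spec L x s -> al (s be) = be (s al).
Proof.
move=> H; have [f sf <-] := dfun_surj x al; have [g sg <-] := dfun_surj x be.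
apply: (etrans (H _ _ (sf 2%N) (sg 2%N))); apply: (etrans _ (esym (H _ _ (sg 2%N) (sf 2%N)))).
have -> : g \* f = f \* g by apply/funext => y /=; rewrite mulrC.
by rewrite addrAC; congr (_ - _ - _); rewrite -!mulrA (mulrC (f x), mulrC (L f x)).
Qed.

Lemma semi_elliptic_ge0 L x (al : 'Hom('rV[R]_n, R^o)) :
  semi_elliptic L -> 0 <= al (symbol L x al).
Proof. by move=> H; have [f sf <-] := dfun_surj x al; exact: H (sf 2%N) x. Qed.

End Symbols.

(** The degenerate case of Cauchy-Schwarz: if the form vanishes at al, its value at t al + be is
    affine in t with slope 2 be(s al), and an affine function bounded below is constant. *)
Lemma psd_null (R : realType) n (s : 'Hom('Hom('rV[R]_n, R^o), 'rV[R]_n))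
    (al : 'Hom('rV[R]_n, R^o)) :
  (forall al be : 'Hom('rV[R]_n, R^o), al (s be) = be (s al)) ->
  (forall al : 'Hom('rV[R]_n, R^o), 0 <= al (s al)) ->
  al (s al) = 0 -> s al = 0.
Proof.
move=> sym ge0 al0; apply: hom_sep => be; rewrite linear0.
apply/eqP; apply/negPn/negP => b0.
set b := be (s al) in b0 *; pose c := be (s be).
(* Solves 2 t b + c = -1, a negative value of the form. *)
pose t := - (c + 1) / (2 * b).
have := ge0 (t *: al + be).
rewrite linearP /= lfunE /= lfunE /= !linearP /= al0 (sym al be) -/b -/c.
rewrite !scaler0 add0r /GRing.scale /=.
have -> : t * b + (t * b + c) = -1 by rewrite /t; field.
by rewrite oppr_ge0 ler10.
Qed.

(** * Frames of the image of the symbol *)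

Lemma basis_mktuple (F : fieldType) (vT : vectType F) (U : {vspace vT}) r (V : 'I_r -> vT) :
  (forall i, V i \in U) -> (\dim U <= r)%N ->
  (forall c : 'I_r -> F, \sum_i c i *: V i = 0 -> forall i, c i = 0) ->
  basis_of U [tuple V i | i < r].
Proof.
move=> VU dU Vfree; rewrite basisEfree size_tuple dU andbT; apply/andP; split.
  apply/freeP => c c0; apply: Vfree; rewrite -[RHS]c0; apply: eq_bigr => i _.
  by rewrite -tnth_nth tnth_mktuple.
by apply/span_subvP => _ /tnthP[i ->]; rewrite tnth_mktuple.
Qed.

Lemma unitmx_inj (F : fieldType) r (M : 'M[F]_r) :
  (forall d : 'rV_r, d *m M = 0 -> d = 0) -> M \in unitmx.
Proof.
move=> H; rewrite -row_free_unit -kermx_eq0; apply/rowV0P => d /sub_kermxP.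
exact: H.
Qed.

Section Determinant.
Context (R : realType) (n : nat) (X : manifoldType R n) (k : nat) (x : X).

Lemma Ck_germ_det r (M : X -> 'M[R]_r) :
  (forall i j, Ck_germ k x (fun y => M y i j)) -> Ck_germ k x (fun y => \det (M y)).
Proof.
move=> CM; rewrite /determinant.
apply: (@Ck_germ_sum _ _ _ k x _ _
  (fun (s : {perm 'I_r}) y => (-1) ^+ s * \prod_i M y i (s i))) => s.
apply: Ck_germZ; exact: (@Ck_germ_prod _ _ _ k x _ _ (fun i y => M y i (s i))).
Qed.

(** Cramer's formula replaces [invmx], whose definition branches on invertibility; as a rational
    expression in the entries it is visibly of class C^k where the determinant is nonzero. *)
Lemma Ck_germ_invmx r (M : X -> 'M[R]_r) i j : M x \in unitmx ->
  (forall i j, Ck_germ k x (fun y => M y i j)) ->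
  Ck_germ k x (fun y => ((\det (M y))^-1 *: \adj (M y)) i j).
Proof.
move=> uM CM.
rewrite (_ : (fun _ => _) = (fun y => (\det (M y))^-1) \*
    (fun y => (-1) ^+ (j + i) * \det (row' j (col' i (M y))))); last first.
  by apply/funext => y; rewrite !mxE.
apply: Ck_germM; first by apply: Ck_germV (Ck_germ_det CM); rewrite -unitfE -unitmxE.
apply/Ck_germZ/Ck_germ_det => a b.
rewrite (_ : (fun _ => _) = fun y => M y (lift j a) (lift i b)); first exact: CM.
by apply/funext => y; rewrite !mxE.
Qed.

End Determinant.

(** * Smooth dependence of the symbol on the point *)

Section SmoothSymbol.
Context (R : realType) (n : nat) (X : manifoldType R n) (L : (X -> R) -> X -> R).
(** The section assumes only consequences of being a smooth diffusion operator, so that it applies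
    to both operators: those for the base are derived from the total space. *)
Hypothesis specL : forall x, symbol_spec L x (symbol L x).
Hypothesis smoothL : smooth_operator L.

Lemma smooth_fun_pairing f g : smooth_fun f -> smooth_fun g ->
  smooth_fun (fun x => dfun f x (symbol L x (dfun g x))).
Proof.
move=> sf sg; have sfg : smooth_fun (f \* g).
  by apply/smooth_funP => x k; apply: Ck_germM; apply: (smooth_funP _).1.
have C h : smooth_fun h -> forall x k, Ck_germ k x h by move=> sh; exact: (smooth_funP _).1.
have CL h : smooth_fun h -> forall x k, Ck_germ k x (L h) by move=> /smoothL/C.
apply/smooth_funP => x k.
rewrite (_ : (fun _ => _) = ((fun x => 2^-1 * L (f \* g) x) \-
   ((fun x => 2^-1 * L f x) \* g)) \- ((fun x => 2^-1 * f x) \* L g)).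
  apply: Ck_germB; last by apply: Ck_germM; [apply/Ck_germZ/C|apply: CL].
  apply: Ck_germB; first by apply/Ck_germZ/CL.
  by apply: Ck_germM; [apply/Ck_germZ/CL|apply: C].
by apply/funext => y; exact: (specL y (sf 2%N) (sg 2%N)).
Qed.

Lemma smooth_vfield_symbol (D : set X) g : open D -> smooth_fun g ->
  smooth_vfield D (fun x => symbol L x (dfun g x)).
Proof.
move=> oD sg; apply/(smooth_vfield_dfun _ oD) => f sf x _ k.
by have /smooth_funP := smooth_fun_pairing sf sg; exact.
Qed.

Hypothesis geL : forall x (al : 'Hom('rV[R]_n, R^o)), 0 <= al (symbol L x al).

Lemma symbol_null x (al : 'Hom('rV[R]_n, R^o)) :
  al (symbol L x al) = 0 -> symbol L x al = 0.
Proof.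
apply: psd_null; last exact: geL.
by move=> a b; exact: symbol_spec_sym (specL x).
Qed.

Definition gram r (f : 'I_r -> X -> R) (x : X) : 'M[R]_r :=
  \matrix_(i, j) dfun (f j) x (symbol L x (dfun (f i) x)).

Lemma gram_comb r (f : 'I_r -> X -> R) x (d : 'rV[R]_r) j :
  (d *m gram f x) 0 j = dfun (f j) x (\sum_i d 0 i *: symbol L x (dfun (f i) x)).
Proof.
by rewrite mxE linear_sum; apply: eq_bigr => i _; rewrite linearZ /= mxE.
Qed.

Lemma smooth_frame r (x0 : X) : (forall x, \dim (symbol_image L x) = r) ->
  exists (f : 'I_r -> X -> R) (U : set X),
  [/\ open U, U x0, forall i, smooth_fun (f i),
      forall x, U x -> gram f x \in unitmx &
      forall x, U x ->
        basis_of (symbol_image L x) [tuple symbol L x (dfun (f i) x) | i < r]].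
Proof.
move=> dimE.
have [b bE] : exists b : r.-tuple 'rV[R]_n, basis_of (symbol_image L x0) b.
  by rewrite -(dimE x0); exists (vbasis (symbol_image L x0)); exact: vbasisP.
have /choice[f fE] : forall i : 'I_r, exists f, smooth_fun f /\ symbol L x0 (dfun f x0) = b`_i.
  move=> i; have /memv_imgP[al _ ->] : b`_i \in limg (symbol L x0).
    by apply: (basis_mem bE); apply: mem_nth; rewrite size_tuple.
  by have [f sf <-] := dfun_surj x0 al; exists f.
have sf i := (fE i).1.
(* A row d killed by the Gram matrix gives a covector sum d_i df_i on which the quadratic form
   vanishes. [symbol_null] turns this into a linear relation between the chosen basis vectors. *)
have u0 : gram f x0 \in unitmx.
  apply: unitmx_inj => d dG.
  pose al := \sum_i d 0 i *: dfun (f i) x0.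
  have sal : symbol L x0 al = \sum_i d 0 i *: symbol L x0 (dfun (f i) x0).
    by rewrite linear_sum; apply: eq_bigr => i _; rewrite linearZ.
  have al0 : al (symbol L x0 al) = 0.
    rewrite {1}/al sum_lfunE big1// => j _; rewrite lfunE /= sal -gram_comb dG mxE.
    by rewrite scaler0.
  have /freeP bfree := basis_free bE.
  apply/rowP => i; rewrite mxE; apply: (bfree (fun i => d 0 i)) => //.
  rewrite -[RHS](symbol_null al0) sal; apply: eq_bigr => j _.
  by rewrite (fE j).2.
have CG i j k x : Ck_germ k x (fun y => gram f y i j).
  rewrite (_ : (fun _ => _) = fun y => dfun (f j) y (symbol L y (dfun (f i) y))).
    by have /smooth_funP := smooth_fun_pairing (sf j) (sf i); exact.
  by apply/funext => y; rewrite mxE.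
have nU : nbhs x0 [set x | \det (gram f x) != 0].
  have cd := Ck_germ_continuous (Ck_germ_det (fun i j => CG i j 0%N x0)).
  have : \forall y \near \det (gram f x0), y != 0.
    by apply: open_nbhs_nbhs; split; [exact: open_neq|rewrite /= -unitfE -unitmxE].
  exact: cd.
have uG x : [set x | \det (gram f x) != 0]° x -> gram f x \in unitmx.
  by move=> /interior_subset /=; rewrite unitmxE unitfE.
exists f, ([set x | \det (gram f x) != 0]°); split=> //; first exact: open_interior.
(* An invertible Gram matrix gives independence only; that the r vectors also span is where the
   constant rank is used. *)
move=> x /uG Gx; apply: basis_mktuple.
- by move=> i; apply: memv_img; exact: memvf.
- by rewrite dimE.
- move=> c c0 i.
  have : (\row_j c j) *m gram f x = 0.
    apply/rowP => j; rewrite gram_comb [RHS]mxE; under eq_bigr do rewrite mxE.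
    by rewrite c0 linear0.
  move=> /(congr1 (mulmx^~ (invmx (gram f x)))); rewrite mulmxK// mul0mx.
  by move=> /rowP/(_ i); rewrite !mxE.
Qed.

Lemma smooth_subbundle_symbol_image : constant_rank_symbol L ->
  smooth_subbundle (symbol_image L).
Proof.
move=> [r dimE]; exists r => x0; have [f [U [oU Ux0 sf _ fb]]] := smooth_frame x0 dimE.
exists U, (fun i x => symbol L x (dfun (f i) x)); split=> //.
by move=> i; exact: smooth_vfield_symbol.
Qed.

End SmoothSymbol.

Section Cotangent.
Context (R : realType) (n m : nat) (X : manifoldType R n) (Y : manifoldType R m).

Lemma cotmap_is_linear (f : X -> Y) (x : X) :
  linear (cotmap f x : 'Hom('rV[R]_m, R^o) -> 'Hom('rV[R]_n, R^o)).
Proof. by move=> c a b; rewrite /cotmap comp_lfunDl comp_lfunZl. Qed.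

HB.instance Definition _ (f : X -> Y) (x : X) :=
  GRing.isLinear.Build R 'Hom('rV[R]_m, R^o) 'Hom('rV[R]_n, R^o) _
    (cotmap f x) (cotmap_is_linear f x).

Lemma cotmapE (f : X -> Y) x (al : 'Hom('rV[R]_m, R^o)) v :
  cotmap f x al v = al (tmap f x v).
Proof. by rewrite /cotmap comp_lfunE. Qed.

End Cotangent.

(** * The horizontal lift *)

Section Lift.
Context (R : realType) (n m k : nat).
Context (M : manifoldType R n) (P : manifoldType R m) (G : lieGroupType R k).
Context (proj : P -> M) (act : P -> G -> P).
Context (B : (P -> R) -> P -> R) (A : (M -> R) -> M -> R).
Hypothesis bundle : principal_bundle proj act.
Hypothesis diffB : diffusion_operator B.
Hypothesis smoothB : smooth_operator B.
Hypothesis equivB : equivariant act B.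
Hypothesis inducedA : induced_operator proj B A.

Lemma proj_smooth_at u : smooth_map_at proj u.
Proof. exact: smooth_on_map_at (proj_smooth bundle) filterT. Qed.

Lemma act_smooth_at a u : smooth_map_at (act^~ a) u.
Proof. exact: (smooth_on_slice (act_smooth bundle) filterT). Qed.

(** The unit slice of a local trivialization. It yields surjectivity of [proj] and carries
    smoothness from the total space down to the base. *)
Lemma section_at x : exists sigma : M -> P,
  smooth_map_at sigma x /\ \forall y \near x, proj (sigma y) = y.
Proof.
have [U [tau [theta [oU Ux [_ sth _ thE _]]]]] := locally_trivial bundle x.
have nU : nbhs x U by exact: open_nbhs_nbhs.
exists (fun y => theta (y, 1%g)); split.
  apply: (smooth_on_slice sth).
  by exists (U, setT); [split=> //; exact: filterT|].
by apply: filterS nU => y Uy; have [] := thE y 1%g Uy.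
Qed.

Lemma proj_surj x : exists u, proj u = x.
Proof. by have [s [_ /nbhs_singleton sx]] := section_at x; exists (s x). Qed.

Lemma Ck_fun_proj l f : Ck_fun l f -> Ck_fun l (f \o proj).
Proof.
move=> /Ck_funP Cf; apply/Ck_funP => u.
by have [_] := proj_smooth_at u; apply; exact: Cf.
Qed.

Lemma Ck_fun_act l f a : Ck_fun l f -> Ck_fun l (f \o act^~ a).
Proof.
move=> /Ck_funP Cf; apply/Ck_funP => u.
by have [_] := act_smooth_at a u; apply; exact: Cf.
Qed.

Lemma dfun_proj f u : Ck_fun 1 f -> dfun (f \o proj) u = cotmap proj u (dfun f (proj u)).
Proof. by move=> /Ck_funP Cf; exact: dfun_comp (proj_smooth_at u) (Cf _). Qed.

Definition pullback_symbol (u : P) : 'Hom('Hom('rV[R]_n, R^o), 'rV[R]_m) :=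
  (symbol B u \o linfun (cotmap proj u))%VF.

Lemma pullback_symbolE u al : pullback_symbol u al = symbol B u (cotmap proj u al).
Proof. exact: etrans (comp_lfunE _ _ _) (congr1 _ (lfunE _ _)). Qed.

Lemma specB u : symbol_spec B u (symbol B u).
Proof. by apply: symbolP; exact: symbol_exists. Qed.

Lemma Ck_fun_leq l l' (f : M -> R) : (l <= l')%N -> Ck_fun l' f -> Ck_fun l f.
Proof. by move=> ll' Cf phi aphi; exact: Ck_on_leq ll' (Cf _ aphi). Qed.

Lemma symbol_spec_induced u : symbol_spec A (proj u)
  (tmap proj u \o pullback_symbol u)%VF.
Proof.
move=> f g Cf Cg; rewrite comp_lfunE pullback_symbolE -cotmapE.
have Cfg : Ck_fun 2 (f \* g).
  apply/Ck_funP => y.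
  exact: Ck_germM ((Ck_funP 2 f).1 Cf y) ((Ck_funP 2 g).1 Cg y).
rewrite -(dfun_proj u (Ck_fun_leq (leqnSn 1) Cf)).
rewrite -(dfun_proj u (Ck_fun_leq (leqnSn 1) Cg)).
apply: (etrans (specB u (Ck_fun_proj Cf) (Ck_fun_proj Cg))) => /=.
by rewrite (inducedA Cf (erefl (proj u))) (inducedA Cg (erefl (proj u)))
  (inducedA Cfg (erefl (proj u))).
Qed.

Lemma symbol_induced u (al : 'Hom('rV[R]_n, R^o)) :
  symbol A (proj u) al = tmap proj u (symbol B u (cotmap proj u al)).
Proof. by rewrite (symbol_eq (symbol_spec_induced u)) comp_lfunE pullback_symbolE. Qed.

Lemma specA x : symbol_spec A x (symbol A x).
Proof.
have [u <-] := proj_surj x; apply: symbolP; eexists; exact: symbol_spec_induced.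
Qed.

Lemma geB u (al : 'Hom('rV[R]_m, R^o)) : 0 <= al (symbol B u al).
Proof. by apply: semi_elliptic_ge0; have [] := diffB. Qed.

Lemma geA x (al : 'Hom('rV[R]_n, R^o)) : 0 <= al (symbol A x al).
Proof. by have [u <-] := proj_surj x; rewrite symbol_induced -cotmapE; exact: geB. Qed.

(** Near x, [A f] is [B (f \o proj)] composed with a local section. *)
Lemma smoothA : smooth_operator A.
Proof.
move=> f sf; apply/smooth_funP => x l.
have [s [ss sx]] := section_at x.
have sB : smooth_fun (B (f \o proj)) by apply: smoothB => j; exact: Ck_fun_proj.
apply: (@Ck_germ_ext _ _ _ _ _ (B (f \o proj) \o s)).
  by apply: filterS sx => y /= sy; rewrite (inducedA (sf 2%N) sy).
by have [_] := ss; apply; exact: (smooth_funP _).1.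
Qed.

Lemma symbol_cotmap_null u (al : 'Hom('rV[R]_n, R^o)) :
  symbol A (proj u) al = 0 -> symbol B u (cotmap proj u al) = 0.
Proof.
move=> al0; apply: (symbol_null specB geB).
by rewrite cotmapE -symbol_induced al0 linear0.
Qed.

(** The inverse in [%VF] is a linear map that selects one preimage of each vector in the image of
    the symbol; its values elsewhere do not matter. *)
Definition lift (u : P) (v : 'rV[R]_n) : 'rV[R]_m :=
  symbol B u (cotmap proj u ((symbol A (proj u))^-1%VF v)).

(** Independence of the covector: the selected preimage and al differ by an element of the kernel of
    the symbol of [A], which the symbol of [B] kills after pullback. *)
Lemma lift_symbol u (al : 'Hom('rV[R]_n, R^o)) :
  lift u (symbol A (proj u) al) = symbol B u (cotmap proj u al).
Proof.
rewrite /lift; set be := (_^-1)%VF _.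
have be0 : symbol A (proj u) (be - al) = 0.
  by rewrite linearB /= limg_lfunVK ?subrr// memv_img// memvf.
have := symbol_cotmap_null be0; rewrite -pullback_symbolE linearB /= => /subr0_eq.
by rewrite !pullback_symbolE.
Qed.

Lemma lift_linear u (c : R) : {in symbol_image A (proj u) &, forall v w,
  lift u (c *: v + w) = c *: lift u v + lift u w}.
Proof.
move=> v w /memv_imgP[al _ ->] /memv_imgP[be _ ->].
have -> : c *: symbol A (proj u) al + symbol A (proj u) be =
          symbol A (proj u) (c *: al + be) by rewrite linearP.
by rewrite !lift_symbol -!pullback_symbolE linearP.
Qed.

Lemma tmap_lift u v : v \in symbol_image A (proj u) -> tmap proj u (lift u v) = v.
Proof. by move=> /memv_imgP[al _ ->]; rewrite lift_symbol -symbol_induced. Qed.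

Definition horizontal (u : P) : {vspace 'rV[R]_m} :=
  limg (pullback_symbol u).

Lemma horizontalP u w :
  reflect (exists al, w = symbol B u (cotmap proj u al)) (w \in horizontal u).
Proof.
apply: (iffP memv_imgP) => [[al _ ->]|[al ->]].
  by exists al; rewrite pullback_symbolE.
by exists al; rewrite ?memvf// pullback_symbolE.
Qed.

Lemma lift_image u : lift u @` [set` symbol_image A (proj u)] = [set` horizontal u].
Proof.
apply/seteqP; split=> [_ [_ /memv_imgP[al _ ->] <-]|w /horizontalP[al ->]].
  by rewrite lift_symbol; apply/horizontalP; exists al.
exists (symbol A (proj u) al); last exact: lift_symbol.
by apply: memv_img; exact: memvf.
Qed.

Lemma tmap_horizontal_bij u :
  set_bij [set` horizontal u] [set` symbol_image A (proj u)] (tmap proj u).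
Proof.
split.
- move=> w /horizontalP[al ->] /=.
  by rewrite -symbol_induced memv_img// memvf.
- move=> w w'; rewrite !inE => /horizontalP[al ->] /horizontalP[be ->].
  (* A horizontal vector is the lift of its own projection, so the projection determines it. *)
  by rewrite -!symbol_induced -!lift_symbol => ->.
- move=> _ /memv_imgP[al _ ->]; exists (symbol B u (cotmap proj u al)).
    by apply/horizontalP; exists al.
  by rewrite -symbol_induced.
Qed.

(** The tangent map of [proj] is injective on horizontal vectors, by [symbol_cotmap_null]. *)
Lemma dim_horizontal u : \dim (horizontal u) = \dim (symbol_image A (proj u)).
Proof.
have -> : symbol_image A (proj u) = (tmap proj u @: horizontal u)%VS.
  by rewrite /symbol_image (symbol_eq (symbol_spec_induced u)) limg_comp.
apply/esym/limg_dim_eq/eqP; rewrite -subv0; apply/subvP => w.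
rewrite memv_cap memv_ker memv0 => /andP[/horizontalP[al ->] /eqP].
by rewrite -symbol_induced => /symbol_cotmap_null ->.
Qed.

(** The covector al is the same on both sides because u and its translate lie over the same point,
    hence use the same chosen chart. Extending al to dg and a test covector to df leaves an identity
    between values of [B]. *)
Lemma tmap_act_symbol u a (al : 'Hom('rV[R]_n, R^o)) :
  tmap (act^~ a) u (symbol B u (cotmap proj u al)) =
  symbol B (act u a) (cotmap proj (act u a) al).
Proof.
apply: hom_sep => be.
have [f sf <-] := dfun_surj (act u a) be.
have [g sg gE] := dfun_surj (proj u) al.
have cg : cotmap proj (act u a) al = dfun (g \o proj) (act u a).
  by rewrite (dfun_proj _ (sg 1%N)) (proj_act bundle) gE.
have cu : cotmap proj u al = dfun (g \o proj) u by rewrite (dfun_proj _ (sg 1%N)) gE.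
rewrite cg cu -cotmapE.
have <- : dfun (f \o act^~ a) u = cotmap (act^~ a) u (dfun f (act u a)).
  by apply: dfun_comp (act_smooth_at a u) _; exact: (smooth_funP _).1.
have Cgp := Ck_fun_proj (sg 2%N).
have Cfg : Ck_fun 2 (f \* (g \o proj)).
  apply/Ck_funP => y; exact: Ck_germM ((Ck_funP 2 f).1 (sf 2%N) y) ((Ck_funP 2 _).1 Cgp y).
apply: (etrans (specB u (Ck_fun_act a (sf 2%N)) Cgp)).
apply: (etrans _ (esym (specB (act u a) (sf 2%N) Cgp))).
have E F : Ck_fun 2 F -> B F (act u a) = B (F \o act^~ a) u.
  by move=> CF; have /(congr1 (@^~ u)) := equivB CF a.
(* Functions lifted from the base are invariant under the group, so translation only affects f. *)
have gp : (g \o proj) \o act^~ a = g \o proj.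
  by apply/funext => y /=; rewrite (proj_act bundle).
rewrite (E _ (sf 2%N)) (E _ Cgp) (E _ Cfg) gp /= (proj_act bundle).
by congr (_ * B _ u - _ - _); apply/funext => y /=; rewrite (proj_act bundle).
Qed.

Lemma tmap_act_horizontal u a :
  (tmap (act^~ a) u @: horizontal u)%VS = horizontal (act u a).
Proof.
apply/vspaceP => w; apply/memv_imgP/horizontalP.
  by move=> [_ /horizontalP[al ->] ->]; exists al; rewrite tmap_act_symbol.
move=> [al ->]; exists (symbol B u (cotmap proj u al)).
  by apply/horizontalP; exists al.
by rewrite tmap_act_symbol.
Qed.

Lemma lift_act u a v : v \in symbol_image A (proj u) ->
  lift (act u a) v = tmap (act^~ a) u (lift u v).
Proof.
move=> /memv_imgP[al _ ->]; rewrite lift_symbol tmap_act_symbol -lift_symbol.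
by rewrite (proj_act bundle).
Qed.

Lemma open_preimage_proj (W : set M) : open W -> open (proj @^-1` W).
Proof.
by move=> oW; apply: open_comp => // u _; have [] := proj_smooth_at u.
Qed.

Lemma smooth_fun_proj f : smooth_fun f -> smooth_fun (f \o proj).
Proof. by move=> sf l; exact: Ck_fun_proj. Qed.

Hypothesis rankA : constant_rank_symbol A.

Lemma smooth_subbundle_horizontal : smooth_subbundle horizontal.
Proof.
have [r dimE] := rankA; exists r => u0.
have [f [U [oU Ux0 sf _ fb]]] := smooth_frame specA smoothA geA (proj u0) dimE.
exists (proj @^-1` U), (fun i u => symbol B u (dfun (f i \o proj) u)).
have oU' := open_preimage_proj oU.
split=> // [i|u Uu].
  exact: (smooth_vfield_symbol specB smoothB oU' (smooth_fun_proj (sf i))).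
have dE i : dfun (f i \o proj) u = cotmap proj u (dfun (f i) (proj u)).
  exact: dfun_proj (sf i 1%N).
apply: basis_mktuple.
- by move=> i; apply/horizontalP; exists (dfun (f i) (proj u)); rewrite dE.
- by rewrite dim_horizontal dimE.
(* A linear relation upstairs projects to one in the frame of the image of the symbol of [A]. *)
- move=> c c0; have /freeP fr := basis_free (fb _ Uu); apply: fr.
  rewrite -[RHS](linear0 (tmap proj u)) -c0 linear_sum; apply: eq_bigr => i _.
  by rewrite nth_mktuple linearZ /= dE -symbol_induced.
Qed.

(* In a frame [symbol A (df_i)] of the image of [symbol A], the coefficients of
   a section are obtained from its pairings with the [df_j] by inverting the
   Gram matrix; the lift has the same coefficients in [symbol B (d(f_i \o proj))]. *)
Lemma smooth_lift (W : set M) (V : M -> 'rV[R]_n) : open W -> smooth_vfield W V ->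
  (forall x, W x -> V x \in symbol_image A x) ->
  smooth_vfield (proj @^-1` W) (fun u => lift u (V (proj u))).
Proof.
move=> oW /(smooth_vfield_dfun _ oW) sV VE.
have oW' := open_preimage_proj oW.
apply/(smooth_vfield_dfun _ oW') => g sg u0 Wu0 l.
have [r dimE] := rankA.
have [f [U [oU Ux0 sf fG fb]]] := smooth_frame specA smoothA geA (proj u0) dimE.
pose N x := (\det (gram A f x))^-1 *: \adj (gram A f x).
pose c i x := \sum_j dfun (f j) x (V x) * N x j i.
have Cc i : Ck_germ l (proj u0) (c i).
  apply: (@Ck_germ_sum _ _ _ l _ _ _ (fun j x => dfun (f j) x (V x) * N x j i)) => j.
  apply: Ck_germM; first exact: sV.
  apply: Ck_germ_invmx; first exact: fG.
  move=> a b; rewrite (_ : (fun _ => _) = fun x => dfun (f b) x (symbol A x (dfun (f a) x))).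
    by have /smooth_funP := smooth_fun_pairing specA smoothA (sf b) (sf a); exact.
  by apply/funext => x; rewrite mxE.
have VcE x : W x -> U x -> V x = \sum_i c i x *: symbol A x (dfun (f i) x).
  move=> Wx Ux; have Gx := fG x Ux.
  have NE : N x = invmx (gram A f x) by rewrite /invmx Gx.
  pose d i : R := coord [tuple symbol A x (dfun (f i) x) | i < r] i (V x).
  have Vd : V x = \sum_i (\row_i d i) 0 i *: symbol A x (dfun (f i) x).
    rewrite {1}(coord_basis (fb x Ux) (VE x Wx)); apply: eq_bigr => i _.
    by rewrite mxE nth_mktuple.
  have dE : (\row_j dfun (f j) x (V x)) *m N x = \row_i d i.
    rewrite (_ : \row_j _ = (\row_i d i) *m gram A f x).
      by rewrite NE mulmxK.
    by apply/rowP => j; rewrite gram_comb -Vd mxE.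
  rewrite [LHS]Vd -dE; apply: eq_bigr => i _; congr (_ *: _).
  by rewrite mxE /c; apply: eq_bigr => j _; rewrite mxE.
have n0 : \forall u \near u0, W (proj u) /\ U (proj u).
  apply: open_nbhs_nbhs; split; last by [].
  by apply: openI => //; exact: open_preimage_proj.
apply: (@Ck_germ_ext _ _ _ _ _
  (fun u => \sum_i c i (proj u) * dfun g u (symbol B u (dfun (f i \o proj) u)))).
  apply: filterS n0 => u [Wu Uu].
  rewrite (VcE _ Wu Uu).
  (* Writing V as the symbol of a single covector lets [lift_symbol] apply directly; the sum is
     expanded again on the side of [B]. *)
  have -> : \sum_i c i (proj u) *: symbol A (proj u) (dfun (f i) (proj u)) =
            symbol A (proj u) (\sum_i c i (proj u) *: dfun (f i) (proj u)).
    by rewrite linear_sum; apply: eq_bigr => i _; rewrite linearZ.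
  rewrite lift_symbol -pullback_symbolE linear_sum linear_sum; apply: eq_bigr => i _.
  by rewrite linearZ /= linearZ pullback_symbolE (dfun_proj _ (sf i 1%N)).
apply: (@Ck_germ_sum _ _ _ l _ _ _ (fun i u =>
  c i (proj u) * dfun g u (symbol B u (dfun (f i \o proj) u)))) => i.
apply: Ck_germM; first by have [_] := proj_smooth_at u0; apply; exact: Cc.
by have /smooth_funP := smooth_fun_pairing specB smoothB sg (smooth_fun_proj (sf i)); exact.
Qed.

End Lift.

Theorem theorem1p3 (R : realType) (n m k : nat)
    (M : manifoldType R n) (P : manifoldType R m) (G : lieGroupType R k)
    (proj : P -> M) (act : P -> G -> P)
    (B : (P -> R) -> P -> R) (A : (M -> R) -> M -> R) :
  principal_bundle proj act ->
  diffusion_operator B ->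
  smooth_operator B ->
  equivariant act B ->
  induced_operator proj B A ->
  constant_rank_symbol A ->
  exists (H : P -> {vspace 'rV[R]_m}) (h : P -> 'rV[R]_n -> 'rV[R]_m),
    [/\ semi_connection proj act (symbol_image A) H,
        horizontal_lift_map proj act (symbol_image A) H h &
        forall (u : P) (v : 'rV[R]_n) (alpha : 'Hom('rV[R]_n, R^o)),
          v \in symbol_image A (proj u) ->
          symbol A (proj u) alpha = v ->
          h u v = symbol B u (cotmap proj u alpha)].
Proof.
move=> bundle diffB smoothB equivB inducedA rankA.
exists (horizontal proj B), (lift proj B A); split.
- split.
  + apply: smooth_subbundle_symbol_image rankA.
    * exact: specA bundle diffB inducedA.
    * exact: smoothA bundle smoothB inducedA.
    * exact: geA bundle diffB inducedA.
  + exact: smooth_subbundle_horizontal bundle diffB smoothB inducedA rankA.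
  + exact: tmap_horizontal_bij bundle diffB inducedA.
  + exact: tmap_act_horizontal bundle diffB equivB.
- split.
  + exact: lift_linear bundle diffB inducedA.
  + by move=> u v; exact: tmap_lift bundle diffB inducedA _ _.
  + exact: smooth_lift bundle diffB smoothB inducedA rankA.
  + by move=> u a v; exact: lift_act bundle diffB equivB inducedA _ _ _.
  + exact: lift_image bundle diffB inducedA.
- by move=> u v al _ <-; exact: lift_symbol bundle diffB inducedA _ _.
Qed.
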